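(* Fix $\sigma\in\{-1,0,1\}$, $\epsilon\in[0,1]$, reservoir parameters, and $\Upsilon>0$. For each $N$ let $\theta_i^{(N)}$ be the stationary microscopic profile of the boundary-driven switching system on $V=\{1,\dots,N\}$ with switching rate $\gamma=\gamma_N$, where $\gamma_NN^2\to\Upsilon$ as $N\to\infty$. Then for every $y\in(0,1)$ the limits $\rho_i^{stat}(y):=\lim_{N\to\infty}\theta_i^{(N)}(\lceil yN\rceil)$, $i\in\{0,1\}$, exist and are given as follows. If $\epsilon=0$: $\rho_0^{stat}(y)=\rho_1^{stat}(y)=\rho_{L,0}+(\rho_{R,0}-\rho_{L,0})y$. If $\epsilon>0$, with $B=B_{\epsilon,\Upsilon}=\sqrt{\Upsilon(1+1/\epsilon)}$ and $\Lambda(y)=\frac1{1+\epsilon}[\rho_{R,0}y+\rho_{L,0}(1-y)]+\frac\epsilon{1+\epsilon}[\rho_{R,1}y+\rho_{L,1}(1-y)]$, $$\rho_0^{stat}(y)=\tfrac{\epsilon}{1+\epsilon}\Big[\tfrac{\sinh(B(1-y))}{\sinh B}(\rho_{L,0}-\rho_{L,1})+\tfrac{\sinh(By)}{\sinh B}(\rho_{R,0}-\rho_{R,1})\Big]+\Lambda(y),$$ $$\rho_1^{stat}(y)=\tfrac{1}{1+\epsilon}\Big[\tfrac{\sinh(B(1-y))}{\sinh B}(\rho_{L,1}-\rho_{L,0})+\tfrac{\sinh(By)}{\sinh B}(\rho_{R,1}-\rho_{R,0})\Big]+\Lambda(y).$$ Moreover, when $\epsilon>0$ both limits hold uniformly in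 $y\in(0,1)$.
   Context: Boundary-driven switching system: fix $\sigma\in\{-1,0,1\}$, $N\in\mathbb N$, $V=\{1,\dots,N\}$, $\epsilon\in[0,1]$, $\gamma>0$, and reservoir parameters $\rho_{L,0},\rho_{L,1},\rho_{R,0},\rho_{R,1}\ge0$ (in $[0,1]$ if $\sigma=-1$). Configurations are $\eta=(\eta_0(x),\eta_1(x))_{x\in V}$ with values in $\{0,1\}$ if $\sigma=-1$ and in $\mathbb N_0$ if $\sigma\in\{0,1\}$. Writing $\delta_{(x,i)}$ for one particle at site $x$ in layer $i$, the continuous-time Markov chain has transitions: for $x\in\{1,\dots,N-1\}$, $i\in\{0,1\}$, $\eta\to\eta-\delta_{(x,i)}+\delta_{(x+1,i)}$ at rate $\epsilon^i\eta_i(x)(1+\sigma\eta_i(x+1))$ and $\eta\to\eta-\delta_{(x+1,i)}+\delta_{(x,i)}$ at rate $\epsilon^i\eta_i(x+1)(1+\sigma\eta_i(x))$ ($\epsilon^0=1$); for $x\in V$, $\eta\to\eta-\delta_{(x,i)}+\delta_{(x,1-i)}$ at rate $\gamma\eta_i(x)(1+\sigma\eta_{1-i}(x))$; and for $i\in\{0,1\}$, $\eta\to\eta-\delta_{(1,i)}$ at rate $\eta_i(1)(1+\sigma\rho_{L,i})$, $\eta\to\eta+\delta_{(1,i)}$ at rate $\rho_{L,i}(1+\sigma\eta_i(1))$, $\eta\to\eta-\delta_{(N,i)}$ at rate $\eta_i(N)(1+\sigma\rho_{R,i})$, $\eta\to\eta+\delta_{(N,i)}$ at rate $\rho_{R,i}(1+\sigma\eta_i(N))$.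 This chain has a unique stationary distribution $\mu_{stat}$, and $\theta_i(x):=\mathbb E_{\mu_{stat}}[\eta_i(x)]$ is the stationary microscopic profile. *)

(* Defs.v *)
From mathcomp Require Import all_boot all_order all_algebra.
From mathcomp Require Import all_classical all_reals all_analysis.
Import Order.TTheory GRing.Theory Num.Theory.
Local Open Scope ring_scope.

Set Implicit Arguments. Unset Strict Implicit. Unset Printing Implicit Defensive.

(* Boundary-driven switching system on V = {1,...,N}, two layers 0 (false) and 1 (true).
   A configuration assigns to each cell (site, layer) a number of particles;
   site x (1-based) is stored at ordinal index x-1. *)
Definition config (N : nat) := {ffun 'I_N * bool -> nat}.

Section Model.
Variable R : realType.
Variable N : nat.

(* eta_i(x), with the convention eta_i(x) = 0 for x outside V *)
Definition occ (eta : config N) (x : nat) (i : bool) : nat :=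
  \sum_(c : 'I_N * bool | (c.1.+1 == x) && (c.2 == i)) eta c.

Definition cell_ind (c : 'I_N * bool) (x : nat) (i : bool) : nat :=
  ((c.1.+1 == x) && (c.2 == i)).

Definition addp (eta : config N) (x : nat) (i : bool) : config N :=
  [ffun c => (eta c + cell_ind c x i)%N].
Definition remp (eta : config N) (x : nat) (i : bool) : config N :=
  [ffun c => (eta c - cell_ind c x i)%N].
Definition movep (eta : config N) (x : nat) (i : bool) (y : nat) (j : bool) : config N :=
  addp (remp eta x i) y j.

Definition valid (sigma : int) (eta : config N) : Prop :=
  sigma = -1 -> forall c, (eta c <= 1)%N.

Definition epsp (eps : R) (i : bool) : R := if i then eps else 1.

Definition layers : seq bool := [:: false; true].

Definition moves (sigma : int) (eps gam : R) (rhoL rhoR : bool -> R)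
    (eta : config N) : seq (config N * R) :=
  let s : R := sigma%:~R in
  let n x i : R := (occ eta x i)%:R in
  [seq (movep eta x i x.+1 i, epsp eps i * n x i * (1 + s * n x.+1 i))
     | x <- iota 1 N.-1, i <- layers]
  ++ [seq (movep eta x.+1 i x i, epsp eps i * n x.+1 i * (1 + s * n x i))
     | x <- iota 1 N.-1, i <- layers]
  ++ [seq (movep eta x i x (~~ i), gam * n x i * (1 + s * n x (~~ i)))
     | x <- iota 1 N, i <- layers]
  ++ [seq (remp eta 1 i, n 1 i * (1 + s * rhoL i)) | i <- layers]
  ++ [seq (addp eta 1 i, rhoL i * (1 + s * n 1 i)) | i <- layers]
  ++ [seq (remp eta N i, n N i * (1 + s * rhoR i)) | i <- layers]
  ++ [seq (addp eta N i, rhoR i * (1 + s * n N i)) | i <- layers].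

Definition rate sigma eps gam rhoL rhoR (eta eta' : config N) : R :=
  \sum_(m <- moves sigma eps gam rhoL rhoR eta | m.1 == eta') m.2.
Definition exit_rate sigma eps gam rhoL rhoR (eta : config N) : R :=
  \sum_(m <- moves sigma eps gam rhoL rhoR eta | m.1 != eta) m.2.

Definition is_stationary sigma eps gam rhoL rhoR (pi : config N -> R) : Prop :=
  [/\ forall eta, valid sigma eta -> 0 <= pi eta,
      (\esum_(eta in [set e | valid sigma e]) (pi eta)%:E = 1)%E &
      forall eta, valid sigma eta ->
        (\esum_(eta' in [set e | valid sigma e /\ e <> eta])
            (pi eta' * rate sigma eps gam rhoL rhoR eta' eta)%:E
         = (pi eta * exit_rate sigma eps gam rhoL rhoR eta)%:E)%E].

Definition theta sigma (pi : config N -> R) (i : bool) (x : nat) : \bar R :=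
  \esum_(eta in [set e | valid sigma e]) (pi eta * (occ eta x i)%:R)%:E.

End Model.

Definition sinh {R : realType} (x : R) : R := (expR x - expR (- x)) / 2.

Definition site {R : realType} (y : R) (N : nat) : nat := `|Num.ceil (y * N%:R)|%N.

Definition Lambda {R : realType} (eps rL0 rL1 rR0 rR1 y : R) : R :=
  (1 + eps)^-1 * (rR0 * y + rL0 * (1 - y)) + eps / (1 + eps) * (rR1 * y + rL1 * (1 - y)).

Definition rho_stat {R : realType} (eps Ups rL0 rL1 rR0 rR1 : R) (i : bool) (y : R) : R :=
  let B := Num.sqrt (Ups * (1 + eps^-1)) in
  if i then
    (1 + eps)^-1 * (sinh (B * (1 - y)) / sinh B * (rL1 - rL0)
                    + sinh (B * y) / sinh B * (rR1 - rR0)) + Lambda eps rL0 rL1 rR0 rR1 y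
  else
    eps / (1 + eps) * (sinh (B * (1 - y)) / sinh B * (rL0 - rL1)
                       + sinh (B * y) / sinh B * (rR0 - rR1)) + Lambda eps rL0 rL1 rR0 rR1 y.

(* Main.v *)
(** The bulk rates are chosen so that the products [eta_i(x) eta_i(x+1)] cancel in the
generator applied to a linear function of the configuration; the stationary means therefore
solve a closed linear system on [{1, ..., N} x {0, 1}], which is compared with the limit
profile by a maximum principle.

For [sigma = 0, 1] the state space is infinite and only global balance is given, so this
system has to be extracted from truncations to total mass at most [k]. Balance makes the
probability current [flux k] from mass [k] to mass [k + 1] equal to the current back; since the
total mass has drift [influx - (boundary occupation)], the boundary occupation is integrable
and [flux] is summable, so [k * flux k] is small for arbitrarily large [k]. This kills the
truncation error, first for a quadratic Lyapunov function (giving finite first moments), then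
for a single occupation number.

For [eps > 0] the difference of the two limit profiles is an exact eigenfunction of the
discrete Laplacian, with eigenvalue [2 cosh (B / (N + 1)) - 2], and their weighted sum is
affine; the residual is thus [o (N^-2)] in the bulk and [O (1 / N)] at the boundary, and is
dominated by a constant plus a small parabola. For [eps = 0] layer 1 does not diffuse: the
barrier has an extra offset on layer 1, which is large only at the two boundary sites. *)

Require Import Defs.
From mathcomp Require Import all_boot all_order all_algebra.
From mathcomp Require Import all_classical all_reals all_analysis.
From mathcomp Require Import zify ring lra.
Import Order.TTheory GRing.Theory Num.Theory.
Import numFieldNormedType.Exports.
Local Open Scope classical_set_scope.
Local Open Scope ring_scope.

Set Implicit Arguments. Unset Strict Implicit. Unset Printing Implicit Defensive.

(** * Linear observables and the generator *)

Section Configurations.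
Variables (R : realType) (N : nat).
Implicit Types (eta : config N) (w : bool -> nat -> R) (x y : nat) (i j : bool).

Definition mass eta : nat := \sum_c eta c.

Definition wsum w eta : R := \sum_(c : 'I_N * bool) w c.2 c.1.+1 * (eta c)%:R.

Lemma cell_indE x i : (0 < x <= N)%N ->
  exists c0 : 'I_N * bool, [/\ forall c, cell_ind c x i = (c == c0), c0.1.+1 = x & c0.2 = i].
Proof.
case: x => [|x]; first by [].
by move=> /= hx; exists (Ordinal hx, i); split.
Qed.

Lemma occ_cell eta (c : 'I_N * bool) : occ eta c.1.+1 c.2 = eta c.
Proof.
rewrite /occ (bigD1 c) /= ?eqxx // big1 ?addn0 // => -[a b] /andP[/andP[/eqP h /eqP h2]].
by case: c h h2 => a' b' /= [] /val_inj -> ->; rewrite eqxx.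
Qed.

Lemma occ_out eta x i : ~~ (0 < x <= N)%N -> occ eta x i = 0%N.
Proof.
move=> h; rewrite /occ big1 // => -[a b] /= /andP[/eqP ha _].
by move: h (ltn_ord a); rewrite -ha /= => /negP.
Qed.

Lemma wsum_addp w eta x i : (0 < x <= N)%N ->
  wsum w (addp eta x i) = wsum w eta + w i x.
Proof.
move=> /(cell_indE i)[c0 [hc hx hi]].
rewrite /wsum (bigD1 c0) //= [in RHS](bigD1 c0) //= !ffunE hc eqxx hx hi.
rewrite natrD mulrDr mulr1 -!addrA; congr (_ + _); rewrite addrC; congr (_ + _).
by apply: eq_bigr => c /negPf hn; rewrite ffunE hc hn addn0.
Qed.

(** Subtraction in [remp] is truncated, so removal from an empty cell does nothing; such moves carry
    rate 0 and are discarded separately. *)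
Lemma wsum_remp w eta x i : (0 < x <= N)%N -> occ eta x i != 0%N ->
  wsum w (remp eta x i) = wsum w eta - w i x.
Proof.
move=> /(cell_indE i)[c0 [hc hx hi]].
rewrite -hx -hi occ_cell -lt0n => h.
rewrite /wsum (bigD1 c0) //= [in RHS](bigD1 c0) //= !ffunE hx hi hc eqxx.
rewrite natrB // mulrBr mulr1 -!addrA; congr (_ + _); rewrite addrC; congr (_ + _).
by apply: eq_bigr => c /negPf hn; rewrite ffunE hc hn subn0.
Qed.

Lemma wsum_movep w eta x i y j : (0 < x <= N)%N -> (0 < y <= N)%N ->
  occ eta x i != 0%N ->
  wsum w (movep eta x i y j) = wsum w eta - w i x + w j y.
Proof. by move=> hx hy h; rewrite /movep wsum_addp // wsum_remp. Qed.

Lemma wsum_occ w eta :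
  wsum w eta = \sum_(x <- iota 1 N) \sum_(i <- layers) w i x * (occ eta x i)%:R.
Proof.
have -> : iota 1 N = index_iota 1 N.+1 by rewrite /index_iota subn1.
rewrite big_add1 big_mkord /wsum.
rewrite (eq_bigr (fun c : 'I_N * bool => (fun a b => w b a.+1 * (occ eta a.+1 b)%:R) c.1 c.2)).
  rewrite -(pair_bigA _ (fun (a : 'I_N) b => w b a.+1 * (occ eta a.+1 b)%:R)) /=.
  by apply: eq_bigr => a _; rewrite big_bool /layers 2!big_cons big_nil /= addr0 addrC.
by move=> c _ /=; rewrite occ_cell.
Qed.

Lemma massE eta : (mass eta)%:R = wsum (fun _ _ => 1) eta.
Proof. by rewrite /wsum natr_sum; apply: eq_bigr => c _; rewrite mul1r. Qed.

Lemma occE eta x i :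
  (occ eta x i)%:R = wsum (fun j y => ((y == x) && (j == i))%:R) eta.
Proof.
rewrite /wsum /occ natr_sum big_mkcond /=.
by apply: eq_bigr => c _; case: ifP; rewrite ?mul1r ?mul0r.
Qed.

Lemma mass_addp eta x i : (0 < x <= N)%N -> mass (addp eta x i) = (mass eta).+1.
Proof.
move=> /(cell_indE i)[c0 [hc _ _]]; rewrite /mass -addn1.
rewrite (eq_bigr (fun c => eta c + (c == c0))%N); last by move=> c _; rewrite ffunE hc.
rewrite big_split /=; congr addn.
by rewrite (bigD1 c0) //= eqxx big1 // => c /negPf->.
Qed.

Lemma rempK eta x i : (0 < x <= N)%N -> occ eta x i != 0%N ->
  addp (remp eta x i) x i = eta.
Proof.
move=> /(cell_indE i)[c0 [hc <- <-]]; rewrite occ_cell -lt0n => h.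
apply/ffunP => c; rewrite !ffunE /cell_ind.
case: andP => [[/eqP + /eqP +]|_]; last by rewrite addn0 subn0.
by move=> a b; rewrite subnK // -occ_cell a b occ_cell.
Qed.

Lemma mass_remp eta x i : (0 < x <= N)%N -> occ eta x i != 0%N ->
  (mass (remp eta x i)).+1 = mass eta.
Proof. by move=> hx h; rewrite -(mass_addp _ i hx) rempK. Qed.

Lemma mass_movep eta x i y j : (0 < x <= N)%N -> (0 < y <= N)%N ->
  occ eta x i != 0%N -> mass (movep eta x i y j) = mass eta.
Proof. by move=> hx hy h; rewrite /movep mass_addp // mass_remp. Qed.

Lemma occ_le_mass eta x i : (occ eta x i <= mass eta)%N.
Proof. by rewrite /occ /mass big_mkcond leq_sum // => c _; case: ifP. Qed.

Lemma wsum_ge0 w eta : (forall j y, (0 < y <= N)%N -> 0 <= w j y) -> 0 <= wsum w eta.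
Proof. by move=> h; apply: sumr_ge0 => c _; rewrite mulr_ge0 // h //=. Qed.

Lemma wsum_le w (M : R) eta : (forall j y, (0 < y <= N)%N -> w j y <= M) ->
  wsum w eta <= M * (mass eta)%:R.
Proof.
move=> h; rewrite massE /wsum mulr_sumr; apply: ler_sum => c _.
by rewrite mul1r ler_wpM2r // h //=.
Qed.

Lemma valid_remp sigma eta x i : valid sigma eta -> valid sigma (remp eta x i).
Proof. by move=> h hs c; rewrite ffunE (leq_trans (leq_subr _ _)) // h. Qed.

Lemma valid_addp sigma eta x i : valid sigma eta ->
  (sigma = -1 -> occ eta x i = 0%N) -> valid sigma (addp eta x i).
Proof.
move=> h h0 hs c; rewrite ffunE /cell_ind; case: andP => [[/eqP hx /eqP hi]|_].
  by rewrite -occ_cell hx hi h0.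
by rewrite addn0 h.
Qed.

Lemma occ_remp_le eta x i y j : (occ (remp eta x i) y j <= occ eta y j)%N.
Proof. by rewrite /occ leq_sum // => c _; rewrite ffunE leq_subr. Qed.

Lemma valid_movep sigma eta x i y j : valid sigma eta ->
  (sigma = -1 -> occ eta y j = 0%N) -> valid sigma (movep eta x i y j).
Proof.
move=> h h0; apply: valid_addp; first exact: valid_remp.
by move=> hs; apply/eqP; rewrite -leqn0 -(h0 hs) occ_remp_le.
Qed.

Lemma valid_occ sigma eta x i : valid sigma eta -> sigma = -1 -> (occ eta x i <= 1)%N.
Proof.
move=> h hs; have [/(cell_indE i)[c [_ <- <-]]|/occ_out->//] := boolP (0 < x <= N)%N.
by rewrite occ_cell h.
Qed.

(** Each occupation number is at most the total mass, so maps into ['I_k.+1] already reach the whole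
    ball. *)
Definition cball (k : nat) : seq (config N) :=
  [seq e <- undup (map (fun g : {ffun 'I_N * bool -> 'I_k.+1} =>
    [ffun c => val (g c)] : config N) (enum {ffun 'I_N * bool -> 'I_k.+1}))
  | (mass e <= k)%N].

Lemma cball_uniq k : uniq (cball k).
Proof. exact/filter_uniq/undup_uniq. Qed.

Lemma mem_cball k eta : (eta \in cball k) = (mass eta <= k)%N.
Proof.
rewrite mem_filter mem_undup; case: leqP => //= h.
apply/mapP; exists [ffun c => inord (eta c)]; first by rewrite mem_enum.
apply/ffunP => c; rewrite !ffunE /= inordK //.
rewrite ltnS (leq_trans _ h) // /mass (bigD1 c) //= leq_addr //.
Qed.

Lemma mem_bulk x : x \in iota 1 N.-1 -> (0 < x <= N)%N /\ (0 < x.+1 <= N)%N.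
Proof. by rewrite mem_iota; lia. Qed.

Lemma mem_site x : x \in iota 1 N -> (0 < x <= N)%N.
Proof. by rewrite mem_iota; lia. Qed.

End Configurations.

(** * The generator acting on linear observables and on the total mass *)

Section Generator.
Variables (R : realType) (N : nat) (sigma : int) (eps gam : R) (rhoL rhoR : bool -> R).
Hypothesis N_gt0 : (0 < N)%N.
Hypothesis sigmaP : sigma \in [:: -1; 0; 1].
Hypothesis eps_ge0 : 0 <= eps.
Hypothesis gam_gt0 : 0 < gam.
Hypothesis rhoL_ge0 : forall i, 0 <= rhoL i.
Hypothesis rhoR_ge0 : forall i, 0 <= rhoR i.
Hypothesis rhoL_le1 : sigma = -1 -> forall i, rhoL i <= 1.
Hypothesis rhoR_le1 : sigma = -1 -> forall i, rhoR i <= 1.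
Implicit Types (eta : config N) (w : bool -> nat -> R) (x y : nat) (i j : bool).

Local Notation s := (sigma%:~R : R).
Local Notation mv := (moves sigma eps gam rhoL rhoR).
Local Notation ep := (epsp eps).

(** The sum runs over listed moves, not over distinct targets: moves with a common target add up,
    and a move fixing [eta] contributes 0. *)
Definition gen (f : config N -> R) eta : R := \sum_(m <- mv eta) m.2 * (f m.1 - f eta).

(** The closed form of [gen] on linear observables, free of [sigma] and stated for an arbitrary real
    array [n] in place of occupation numbers. *)
Definition genW w (n : nat -> bool -> R) : R :=
  \sum_(x <- iota 1 N.-1) \sum_(i <- layers) ep i * (w i x.+1 - w i x) * (n x i - n x.+1 i)
  + \sum_(x <- iota 1 N) \sum_(i <- layers) gam * n x i * (w (~~ i) x - w i x)
  + \sum_(i <- layers) ((rhoL i - n 1%N i) * w i 1%N + (rhoR i - n N i) * w i N).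

Lemma sum_moves eta (G : config N * R -> R) :
  \sum_(m <- mv eta) G m =
  let n x i : R := (occ eta x i)%:R in
  (\sum_(x <- iota 1 N.-1) \sum_(i <- layers)
      (G (movep eta x i x.+1 i, ep i * n x i * (1 + s * n x.+1 i))
     + G (movep eta x.+1 i x i, ep i * n x.+1 i * (1 + s * n x i))))
  + (\sum_(x <- iota 1 N) \sum_(i <- layers)
      G (movep eta x i x (~~ i), gam * n x i * (1 + s * n x (~~ i))))
  + \sum_(i <- layers)
     ((G (remp eta 1 i, n 1%N i * (1 + s * rhoL i))
     + G (addp eta 1 i, rhoL i * (1 + s * n 1%N i)))
     + (G (remp eta N i, n N i * (1 + s * rhoR i))
     + G (addp eta N i, rhoR i * (1 + s * n N i)))).
Proof.
rewrite /moves !big_cat !big_allpairs_dep !big_map /=.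
rewrite !big_split /= !addrA; congr (_ + _ + _ + _ + _ + _).
by rewrite -big_split /=; apply: eq_bigr => x _; rewrite big_split.
Qed.

Let range1 : (0 < 1 <= N)%N. Proof. by rewrite N_gt0. Qed.
Let rangeN : (0 < N <= N)%N. Proof. by rewrite N_gt0 leqnn. Qed.

Let occ0 eta x i : (occ eta x i = 0%N) \/ (occ eta x i != 0%N).
Proof. by case: eqP; [left|right]. Qed.

(** The [sigma] terms cancel in pairs: between the two opposite hops across a bond, between the two
    layers at a site, and between injection and removal at a reservoir. *)
Lemma gen_wsum w eta : gen (wsum w) eta = genW w (fun x i => (occ eta x i)%:R).
Proof.
rewrite /gen sum_moves /=; congr (_ + _ + _).
- apply: eq_big_seq => x /mem_bulk[hx hx1]; apply: eq_bigr => i _.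
  have -> : forall r1, r1 * (occ eta x i)%:R * (1 + s * (occ eta x.+1 i)%:R)
      * (wsum w (movep eta x i x.+1 i) - wsum w eta) =
      r1 * (occ eta x i)%:R * (1 + s * (occ eta x.+1 i)%:R) * (w i x.+1 - w i x).
    move=> r1; case: (occ0 eta x i) => [->|h]; first by rewrite !mulr0 !mul0r.
    by rewrite wsum_movep //; ring.
  have -> : forall r1, r1 * (occ eta x.+1 i)%:R * (1 + s * (occ eta x i)%:R)
      * (wsum w (movep eta x.+1 i x i) - wsum w eta) =
      r1 * (occ eta x.+1 i)%:R * (1 + s * (occ eta x i)%:R) * (w i x - w i x.+1).
    move=> r1; case: (occ0 eta x.+1 i) => [->|h]; first by rewrite !mulr0 !mul0r.
    by rewrite wsum_movep //; ring.
  ring.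
- have hsw x i : (0 < x <= N)%N -> gam * (occ eta x i)%:R * (1 + s * (occ eta x (~~ i))%:R)
      * (wsum w (movep eta x i x (~~ i)) - wsum w eta) =
      gam * (occ eta x i)%:R * (1 + s * (occ eta x (~~ i))%:R) * (w (~~ i) x - w i x).
    move=> hx; case: (occ0 eta x i) => [->|h]; first by rewrite !mulr0 !mul0r.
    by rewrite wsum_movep //; ring.
  apply: eq_big_seq => x /mem_site hx.
  rewrite /layers !big_cons !big_nil !hsw //=; ring.
- have hrem x i r1 : (0 < x <= N)%N -> (occ eta x i)%:R * r1
      * (wsum w (remp eta x i) - wsum w eta) = - ((occ eta x i)%:R * r1 * w i x).
    move=> hx; case: (occ0 eta x i) => [->|h]; first by rewrite !mul0r oppr0.
    by rewrite wsum_remp //; ring.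
  apply: eq_bigr => i _; rewrite !hrem // !wsum_addp //; ring.
Qed.

Lemma exclusion_factor_ge0 eta x i : valid sigma eta -> 0 <= 1 + s * (occ eta x i)%:R.
Proof.
move=> h; move: sigmaP; rewrite !inE => /or3P[]/eqP hs.
- have := valid_occ x i h hs; rewrite hs mulrN1z -(ler_nat R); lra.
- by rewrite hs mul0r addr0.
- by rewrite hs mulr1z mul1r addr_ge0.
Qed.

Lemma exclusion_factor_occ eta x i : valid sigma eta -> 1 + s * (occ eta x i)%:R != 0 ->
  sigma = -1 -> occ eta x i = 0%N.
Proof.
move=> h h0 hs; have := valid_occ x i h hs.
by case: (occ eta x i) h0 => [|[|//]] //; rewrite hs mulrN1z mulr1 subrr eqxx.
Qed.

Lemma reservoir_factor_ge0 (r : R) : 0 <= r -> (sigma = -1 -> r <= 1) -> 0 <= 1 + s * r.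
Proof.
move=> r0 r1; move: sigmaP; rewrite !inE => /or3P[]/eqP hs.
- by have := r1 hs; rewrite hs mulrN1z; lra.
- by rewrite hs mul0r addr0.
- by rewrite hs mulr1z mul1r addr_ge0.
Qed.

Lemma epsp_ge0 i : 0 <= ep i. Proof. by case: i => //=. Qed.

(** Moves of rate 0 stay in the list and their targets may violate exclusion, hence the guard
    [m.2 != 0]. That mass changes by at most one is what makes truncation by mass work. *)
Lemma movesP eta m : valid sigma eta -> m \in mv eta ->
  0 <= m.2 /\ (m.2 != 0 -> [/\ valid sigma m.1, (mass m.1 <= (mass eta).+1)%N &
                             (mass eta <= (mass m.1).+1)%N]).
Proof.
move=> hv; rewrite /moves !mem_cat.
have mvP r x i y j : 0 <= r -> (0 < x <= N)%N -> (0 < y <= N)%N ->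
   let m := (movep eta x i y j, r * (occ eta x i)%:R * (1 + s * (occ eta y j)%:R)) in
   0 <= m.2 /\ (m.2 != 0 -> [/\ valid sigma m.1, (mass m.1 <= (mass eta).+1)%N &
                             (mass eta <= (mass m.1).+1)%N]).
  move=> r0 hx hy /=; split.
    by rewrite !mulr_ge0 // exclusion_factor_ge0.
  rewrite !mulf_eq0 !negb_or pnatr_eq0 => /andP[/andP[_ h1] h2].
  rewrite mass_movep // leqnSn; split => //.
  apply: valid_movep => //; exact: exclusion_factor_occ.
have remP r x i : 0 <= r -> (0 < x <= N)%N ->
   let m := (remp eta x i, (occ eta x i)%:R * r) in
   0 <= m.2 /\ (m.2 != 0 -> [/\ valid sigma m.1, (mass m.1 <= (mass eta).+1)%N &
                             (mass eta <= (mass m.1).+1)%N]).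
  move=> r0 hx /=; split; first by rewrite mulr_ge0.
  rewrite mulf_eq0 negb_or pnatr_eq0 => /andP[h1 _].
  have := mass_remp hx h1; split; [exact: valid_remp|lia|lia].
have addP r x i : 0 <= r -> (0 < x <= N)%N ->
   let m := (addp eta x i, r * (1 + s * (occ eta x i)%:R)) in
   0 <= m.2 /\ (m.2 != 0 -> [/\ valid sigma m.1, (mass m.1 <= (mass eta).+1)%N &
                             (mass eta <= (mass m.1).+1)%N]).
  move=> r0 hx /=; split; first by rewrite mulr_ge0 // exclusion_factor_ge0.
  rewrite mulf_eq0 negb_or => /andP[_ h1].
  rewrite mass_addp //; split=> //; last lia.
  apply: valid_addp => //; exact: exclusion_factor_occ.
have eg := epsp_ge0; have g0 := ltW gam_gt0.
have fL i := reservoir_factor_ge0 (rhoL_ge0 i) (rhoL_le1^~ i).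
have fR i := reservoir_factor_ge0 (rhoR_ge0 i) (rhoR_le1^~ i).
case/or4P => [/allpairsP[[x i] /= [/mem_bulk[hx hx1] _ ->]]
  |/allpairsP[[x i] /= [/mem_bulk[hx hx1] _ ->]]
  |/allpairsP[[x i] /= [/mem_site hx _ ->]]|/or4P[] /mapP[i _ ->]].
- exact: mvP.
- exact: mvP.
- exact: mvP.
- exact: remP.
- exact: addP.
- exact: remP.
- exact: addP.
Qed.

Definition up_rate eta : R := \sum_(m <- mv eta) m.2 * (mass eta < mass m.1)%N%:R.
Definition down_rate eta : R := \sum_(m <- mv eta) m.2 * (mass m.1 < mass eta)%N%:R.
Definition bdry (n : nat -> bool -> R) : R := \sum_(i <- layers) (n 1%N i + n N i).
(** The constant part of the mass drift in [gen_mass_bdry]; the actual injection rate also depends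
    on the occupation of the end sites. *)
Definition influx : R := \sum_(i <- layers) (rhoL i + rhoR i).

Lemma gen_mass eta : valid sigma eta ->
  up_rate eta - down_rate eta = gen (fun e => (mass e)%:R) eta.
Proof.
move=> hv; rewrite /up_rate /down_rate /gen -sumrB.
apply: eq_big_seq => m hm; have [_ h] := movesP hv hm.
have [->|/h[_ h1 h2]] := eqVneq m.2 0; first by rewrite !mul0r subrr.
rewrite -mulrBr; congr (_ * _).
have : [\/ mass m.1 = mass eta, mass m.1 = (mass eta).+1 | mass eta = (mass m.1).+1].
  move: h1 h2; rewrite leq_eqVlt => /predU1P[->|]; first by constructor 2.
  rewrite ltnS => le1; rewrite leq_eqVlt => /predU1P[->|]; first by constructor 3.
  by rewrite ltnS => le2; constructor 1; apply/eqP; rewrite eqn_leq le1.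
case=> [->|->|->]; rewrite ?ltnn ?ltnSn ?subrr //.
- by rewrite ltnNge leqnSn /= -[(mass eta).+1%:R]natr1; lra.
- by rewrite ltnNge leqnSn /= -[(mass m.1).+1%:R]natr1; lra.
Qed.

Lemma gen_mass_bdry eta :
  gen (fun e => (mass e)%:R) eta = influx - bdry (fun x i => (occ eta x i)%:R).
Proof.
have -> : gen (fun e => (mass e)%:R) eta = gen (wsum (fun _ _ => 1)) eta.
  by apply: eq_bigr => m _; rewrite !massE.
rewrite gen_wsum /genW big1 ?add0r; last first.
  by move=> x _; rewrite big1 // => i _; rewrite subrr mulr0 mul0r.
rewrite big1 ?add0r; last by move=> x _; rewrite big1 // => i _; rewrite subrr mulr0.
rewrite -sumrB; apply: eq_bigr => i _; ring.
Qed.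

Lemma up_rate_ge0 eta : valid sigma eta -> 0 <= up_rate eta.
Proof.
move=> hv; rewrite /up_rate big_seq; apply: sumr_ge0 => m /(movesP hv)[h _].
by rewrite mulr_ge0.
Qed.

(** Only injections raise the mass, and [1 + s * n <= 1 + n] for each admissible [sigma]. A bound
    through the boundary occupation suffices because [Eball_bdry] controls its expectation. *)
Lemma up_rate_le eta : valid sigma eta ->
  up_rate eta <= influx + influx * bdry (fun x i => (occ eta x i)%:R).
Proof.
move=> hv; rewrite /up_rate sum_moves /=.
have mv0 r x i y j r2 : (0 < x <= N)%N -> (0 < y <= N)%N ->
    r * (occ eta x i)%:R * r2 * (mass eta < mass (movep eta x i y j))%N%:R = 0.
  move=> hx hy; case: (occ0 eta x i) => [->|h]; first by rewrite !mulr0 !mul0r.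
  by rewrite mass_movep // ltnn mulr0.
rewrite big_seq big1; last first.
  by move=> x /mem_bulk[hx hx1]; rewrite big1 // => i _; rewrite !mv0 ?addr0.
rewrite big_seq big1; last first.
  by move=> x /mem_site hx; rewrite big1 // => i _; rewrite !mv0 ?addr0.
have rm0 r x i : (0 < x <= N)%N ->
    (occ eta x i)%:R * r * (mass eta < mass (remp eta x i))%N%:R = 0.
  move=> hx; case: (occ0 eta x i) => [->|h]; first by rewrite !mul0r.
  by rewrite -(mass_remp hx h) ltnNge leqnSn mulr0.
have ad0 r x i : (0 < x <= N)%N -> 0 <= r ->
    r * (1 + s * (occ eta x i)%:R) * (mass eta < mass (addp eta x i))%N%:R
    <= r * (1 + (occ eta x i)%:R).
  move=> hx r0; rewrite mass_addp // ltnSn mulr1 ler_wpM2l // lerD2l.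
  rewrite ler_piMl //; move: sigmaP; rewrite !inE => /or3P[]/eqP ->.
  + by rewrite mulrN1z; lra.
  + by rewrite mulr0z ler01.
  + by rewrite mulr1z.
rewrite !add0r.
have : forall i, 0 <= (occ eta 1 i)%:R :> R by [].
have : forall i, 0 <= (occ eta N i)%:R :> R by [].
rewrite /influx /bdry /layers !big_cons !big_nil !rm0 //.
have := ad0 (rhoL false) 1%N false range1 (rhoL_ge0 _).
have := ad0 (rhoL true) 1%N true range1 (rhoL_ge0 _).
have := ad0 (rhoR false) N false rangeN (rhoR_ge0 _).
have := ad0 (rhoR true) N true rangeN (rhoR_ge0 _).
move: (rhoL_ge0 false) (rhoL_ge0 true) (rhoR_ge0 false) (rhoR_ge0 true).
set a1 := rhoL _; set a2 := rhoL _; set a3 := rhoR _; set a4 := rhoR _.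
move=> p1 p2 p3 p4 q1 q2 q3 q4 hN h1.
have := hN false; have := hN true; have := h1 false; have := h1 true.
move: q1 q2 q3 q4.
set b1 := (occ _ 1 _)%:R; set b2 := (occ _ 1 _)%:R.
set b3 := (occ _ N _)%:R; set b4 := (occ _ N _)%:R.
move=> q1 q2 q3 q4 r1 r2 r3 r4.
have X (a b : R) : 0 <= a -> 0 <= b -> 0 <= a * b by exact: mulr_ge0.
rewrite ?add0r ?addr0.
apply: le_trans (_ : _ <= a1 * (1 + b2) + a3 * (1 + b4) + (a2 * (1 + b1) + a4 * (1+b3))) _.
  by rewrite lerD // lerD.
by rewrite -subr_ge0; nra.
Qed.

End Generator.

(** * Stationarity on finite truncations *)

(** Serves to make the inflow sum in global balance finite: its sources have mass at most one more
    than the target. *)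
Lemma esum_finsupp (R : realType) (T : choiceType) (S : set T) (s : seq T) (a : T -> \bar R) :
  uniq s -> (forall x, S x -> (0 <= a x)%E) -> (forall x, S x -> x \notin s -> a x = 0%E) ->
  (\esum_(x in S) a x = \sum_(x <- s | x \in S) a x)%E.
Proof.
move=> us a0 as0.
transitivity (\esum_(x in S `&` [set` s]) a x)%E.
  rewrite esum_mkcondr; apply: eq_esum => x Sx.
  by case: ifPn => //; rewrite mem_setE => /(as0 _ Sx).
have -> : S `&` [set` s] = [set` [seq x <- s | x \in S]].
  apply/seteqP; split => x /=; rewrite mem_filter; last by move=> /andP[/set_mem].
  by move=> [Sx xs]; rewrite mem_set.
rewrite esum_fset.
- by rewrite -fsbig_seq ?filter_uniq // big_filter.
- exact: finite_seq.
- by move=> x; rewrite mem_setE mem_filter => /andP[/set_mem/a0].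
Qed.

(** The sum is a supremum over finite subsets, and each of these lies in some [s k]. *)
Lemma esum_le_exhaust (R : realType) (T : choiceType) (S : set T) (s : nat -> seq T)
    (a : T -> \bar R) (b : \bar R) :
  (forall k, uniq (s k)) -> (forall x, S x -> (0 <= a x)%E) ->
  (forall A : seq T, exists k, {subset A <= s k}) ->
  (forall k, (\sum_(x <- s k | x \in S) a x <= b)%E) -> (\esum_(x in S) a x <= b)%E.
Proof.
move=> us a0 sA hb; apply: ge_ereal_sup => _ [X [finX XS] <-].
have [A XA] : exists A : seq T, X = [set` A] by apply/finite_seqP.
have [k hk] := sA A; apply: le_trans (hb k).
rewrite -(esum_fset finX); last by move=> x /set_mem/XS/a0.
rewrite (@esum_finsupp _ _ X (s k)) //.
- rewrite big_mkcond [leRHS]big_mkcond; apply: lee_sum => x _.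
  case: ifPn => [/set_mem/XS Sx|_]; first by rewrite mem_set.
  by case: ifPn => [/set_mem/a0|].
- by move=> x /XS/a0.
- by move=> x; rewrite XA /= => /hk ->.
Qed.

(** Otherwise [a] would dominate [e] times the harmonic sequence from [K] on, and the harmonic
    series diverges. *)
Lemma harmonic_weight_small (R : realType) (a : nat -> R) (C : R) :
  (forall n, \sum_(0 <= j < n) a j <= C) -> (forall n, 0 <= a n) ->
  forall (e : R) K, 0 < e -> exists2 k, (K <= k)%N & k.+1%:R * a k < e.
Proof.
move=> aC a0 e K e0; apply: contrapT => hn.
have ha k : (K <= k)%N -> e * harmonic k <= a k.
  move=> Kk; rewrite /harmonic /= ler_pdivrMr // mulrC leNgt; apply/negP => h.
  by apply: hn; exists k.
have bnd n : \sum_(0 <= j < n) (harmonic j : R) <= \sum_(0 <= j < K) (harmonic j : R) + e^-1 * C.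
  have C0 : 0 <= C by have := aC 0%N; rewrite big_geq.
  have e1 : 0 <= e^-1 * C by rewrite mulr_ge0 // invr_ge0 ltW.
  have [nK|Kn] := leqP n K.
    rewrite (big_cat_nat _ nK) //= -addrA lerDl addr_ge0 //.
    by apply: sumr_ge0 => i _; exact: harmonic_ge0.
  rewrite (big_cat_nat _ (ltnW Kn)) //= lerD2l mulrC ler_pdivlMr //.
  rewrite mulrC mulr_sumr; apply: le_trans (aC n).
  rewrite [leRHS](big_cat_nat (leq0n K) (ltnW Kn)) //= -[leLHS]add0r lerD //.
    by apply: sumr_ge0.
  by rewrite big_nat [leRHS]big_nat; apply: ler_sum => i /andP[/ha].
apply: (@dvg_harmonic R); apply: nondecreasing_is_cvgn.
  apply/nondecreasing_seqP => n; rewrite /series /= big_nat_recr //= lerDl.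
  exact: harmonic_ge0.
by exists (\sum_(0 <= j < K) (harmonic j : R) + e^-1 * C) => _ [n _ <-]; exact: bnd.
Qed.

(** The cutoff indicator changes only on jumps between the levels [k] and [k.+1]. *)
Lemma trunc_jump (R : pzRingType) k (n n' : nat) : (n' <= n.+1)%N -> (n <= n'.+1)%N ->
  (n' <= k)%N%:R - (n <= k)%N%:R =
  (n == k.+1)%:R * (n' < n)%N%:R - (n == k)%:R * (n < n')%N%:R :> R.
Proof.
move=> h1 h2; have [e|[e|[e|e]]] : (n < k \/ n = k \/ n = k.+1 \/ k.+1 < n)%N by lia.
- have -> : (n' <= k)%N by lia.
  have -> : (n <= k)%N by lia.
  have -> : (n == k.+1) = false by lia.
  have -> : (n == k) = false by lia.
  by rewrite !mul0r !subrr.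
- subst n; rewrite leqnn eqxx mul1r leqNgt.
  have -> : (k == k.+1) = false by lia.
  by case: (k < n')%N; rewrite ?mul0r ?sub0r ?subrr ?subr0 ?oppr0.
- subst n; rewrite eqxx ltnS ltnn.
  have -> : (k.+1 == k) = false by lia.
  by rewrite mul0r mul1r.
- have -> : (n' <= k)%N = false by lia.
  have -> : (n <= k)%N = false by lia.
  have -> : (n == k.+1) = false by lia.
  have -> : (n == k) = false by lia.
  by rewrite !mul0r !subrr.
Qed.

(** * Truncated expectations and probability currents between mass levels *)

Section Stationary.
Variables (R : realType) (N : nat) (sigma : int) (eps gam : R) (rhoL rhoR : bool -> R).
Hypothesis N_gt0 : (0 < N)%N.
Hypothesis sigmaP : sigma \in [:: -1; 0; 1].
Hypothesis eps_ge0 : 0 <= eps.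
Hypothesis gam_gt0 : 0 < gam.
Hypothesis rhoL_ge0 : forall i, 0 <= rhoL i.
Hypothesis rhoR_ge0 : forall i, 0 <= rhoR i.
Hypothesis rhoL_le1 : sigma = -1 -> forall i, rhoL i <= 1.
Hypothesis rhoR_le1 : sigma = -1 -> forall i, rhoR i <= 1.
Variable pi : config N -> R.
Hypothesis pi_stat : is_stationary sigma eps gam rhoL rhoR pi.
Implicit Types (eta : config N) (w : bool -> nat -> R) (x y : nat) (i j : bool).
Implicit Types (F G f W : config N -> R).

Local Notation mv := (moves sigma eps gam rhoL rhoR).
Local Notation gen := (gen sigma eps gam rhoL rhoR).
Local Notation up := (up_rate sigma eps gam rhoL rhoR).
Local Notation down := (down_rate sigma eps gam rhoL rhoR).
Local Notation rate := (rate sigma eps gam rhoL rhoR).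
Local Notation exit := (exit_rate sigma eps gam rhoL rhoR).
Let mvP eta m := @movesP R N sigma eps gam rhoL rhoR N_gt0 sigmaP eps_ge0 gam_gt0
  rhoL_ge0 rhoR_ge0 rhoL_le1 rhoR_le1 eta m.

(* [pi] is unconstrained on configurations that are not valid; [vpi] is zero there. *)
Definition vpi eta : R := if `[< valid sigma eta >] then pi eta else 0.
(** A truncated expectation that is not normalised: [Eball k (fun=> 1)] is at most 1 and only tends
    to 1. *)
Definition Eball (k : nat) F : R := \sum_(eta <- cball N k) vpi eta * F eta.

Lemma vpi_ge0 eta : 0 <= vpi eta.
Proof. by rewrite /vpi; case: ifPn => // /asboolP h; have [+ _ _] := pi_stat; exact. Qed.

Lemma vpi_validP eta : vpi eta = 0 \/ valid sigma eta.
Proof. by rewrite /vpi; case: ifPn => [/asboolP|]; [right|left]. Qed.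

Lemma EballD k F G : Eball k (fun e => F e + G e) = Eball k F + Eball k G.
Proof. by rewrite /Eball -big_split; apply: eq_bigr => e _; rewrite mulrDr. Qed.

Lemma EballB k F G : Eball k (fun e => F e - G e) = Eball k F - Eball k G.
Proof. by rewrite /Eball -sumrB; apply: eq_bigr => e _; rewrite mulrBr. Qed.

Lemma EballZ k c F : Eball k (fun e => c * F e) = c * Eball k F.
Proof. by rewrite /Eball mulr_sumr; apply: eq_bigr => e _; rewrite mulrCA. Qed.

Lemma Eball_le k F G : (forall e, valid sigma e -> F e <= G e) -> Eball k F <= Eball k G.
Proof.
move=> h; apply: ler_sum => e _; have [->|/h le] := vpi_validP e; first by rewrite !mul0r.
by rewrite ler_wpM2l // vpi_ge0.
Qed.

Lemma eq_Eball k F G : (forall e, valid sigma e -> (mass e <= k)%N -> F e = G e) ->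
  Eball k F = Eball k G.
Proof.
move=> h; apply: eq_big_seq => e; rewrite mem_cball => hk.
by have [->|/h->//] := vpi_validP e; rewrite !mul0r.
Qed.

Lemma Eball_trunc k l F : (k <= l)%N ->
  Eball l (fun e => (mass e <= k)%N%:R * F e) = Eball k F.
Proof.
move=> kl; rewrite /Eball.
rewrite (eq_bigr (fun e => if (mass e <= k)%N then vpi e * F e else 0)); last first.
  by move=> e _; case: ifP => _; rewrite ?mul1r // mul0r mulr0.
rewrite -big_mkcond -big_filter; apply: perm_big; apply: uniq_perm.
- by rewrite filter_uniq // cball_uniq.
- exact: cball_uniq.
by move=> e; rewrite mem_filter !mem_cball; apply: andb_idr => h; exact: leq_trans h kl.
Qed.

Lemma Eball_mono k l F : (k <= l)%N -> (forall e, valid sigma e -> 0 <= F e) ->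
  Eball k F <= Eball l F.
Proof.
move=> kl F0; rewrite -(Eball_trunc _ kl); apply: Eball_le => e /F0 h.
by case: (_ <= _)%N; rewrite ?mul1r // mul0r.
Qed.

Lemma Eball_valid k F : (Eball k F)%:E =
  (\sum_(e <- cball N k | e \in [set e | valid sigma e]) (pi e * F e)%:E)%E.
Proof.
rewrite sumEFin; congr EFin; rewrite /Eball big_mkcond [RHS]big_mkcond /=.
apply: eq_bigr => e _; rewrite /vpi.
have -> : (e \in [set e | valid sigma e]) = `[< valid sigma e >].
  by apply/idP/asboolP => [/set_mem//|h]; exact: mem_set.
by case: ifP => //= _; rewrite mul0r.
Qed.

Lemma cball_exhaust (A : seq (config N)) : exists k, {subset A <= cball N k}.
Proof.
elim: A => [|e A [k hk]]; first by exists 0%N.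
exists (maxn (mass e) k) => e'; rewrite in_cons mem_cball => /predU1P[->|/hk].
  exact: leq_maxl.
by rewrite mem_cball => h; rewrite (leq_trans h) // leq_maxr.
Qed.

Lemma Eball_le_esum k F : (forall e, valid sigma e -> 0 <= F e) ->
  ((Eball k F)%:E <= \esum_(e in [set e | valid sigma e]) (pi e * F e)%:E)%E.
Proof.
move=> F0; have pF0 e : valid sigma e -> 0 <= pi e * F e.
  by move=> hv; rewrite mulr_ge0 // ?F0 //; have [+ _ _] := pi_stat; exact.
rewrite Eball_valid -big_filter.
have us : uniq [seq e <- cball N k | e \in [set e | valid sigma e]].
  by rewrite filter_uniq // cball_uniq.
apply: ereal_sup_ubound; exists [set` [seq e <- cball N k | e \in [set e | valid sigma e]]].
  split; first exact: finite_seq.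
  by move=> e /=; rewrite mem_filter => /andP[/set_mem].
by rewrite -fsbig_seq.
Qed.

Lemma esum_le_Eball F (b : R) : (forall e, valid sigma e -> 0 <= F e) ->
  (forall k, Eball k F <= b) ->
  (\esum_(e in [set e | valid sigma e]) (pi e * F e)%:E <= b%:E)%E.
Proof.
move=> F0 hb; apply: (@esum_le_exhaust _ _ _ (cball N)).
- exact: cball_uniq.
- move=> e hv; rewrite lee_fin mulr_ge0 // ?F0 //; have [+ _ _] := pi_stat; exact.
- exact: cball_exhaust.
- by move=> k; rewrite -Eball_valid lee_fin.
Qed.

(** [Eball k F] is nondecreasing and bounded; the full sum lies above every term and below their
    supremum, which is the limit. *)
Lemma Eball_cvg F (b : R) : (forall e, valid sigma e -> 0 <= F e) ->
  (forall k, Eball k F <= b) ->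
  exists2 l : R, (\esum_(e in [set e | valid sigma e]) (pi e * F e)%:E = l%:E)%E &
    (fun k => Eball k F) @ \oo --> l.
Proof.
move=> F0 hb.
have nd : nondecreasing_seq (fun k => Eball k F).
  by move=> k l kl; exact: Eball_mono.
have hub : has_ubound (range (fun k => Eball k F)) by exists b => _ [k _ <-].
have hc := nondecreasing_cvgn nd hub.
set l := sup _ in hc; exists l => //.
apply/eqP; rewrite eq_le; apply/andP; split.
  apply: esum_le_Eball => // k; apply: ub_le_sup => //; by exists k.
have := esum_le_Eball F0 hb.
have := fun k => Eball_le_esum k F0.
(* The bounds from both sides exclude the two infinite values. *)
case: (esum _ _) => [r h _|//|h _]; last by have := h 0%N.
rewrite lee_fin; apply: ge_sup; first by exists (Eball 0 F), 0%N.
by move=> _ [k _ <-]; have := h k; rewrite lee_fin.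
Qed.

Lemma rate_eq0 eta eta' : valid sigma eta' ->
  ~ valid sigma eta \/ ((mass eta).+1 < mass eta')%N -> rate eta' eta = 0.
Proof.
move=> hv h; rewrite /rate big_seq_cond big1 // => m /andP[hm /eqP me].
apply/eqP/negPn/negP => /(proj2 (mvP hv hm)); rewrite me => -[v1 _ t1].
by case: h => //; rewrite ltnNge t1.
Qed.

Lemma rate_ge0 eta eta' : valid sigma eta' -> 0 <= rate eta' eta.
Proof.
move=> hv; rewrite /rate big_seq_cond; apply: sumr_ge0 => m /andP[hm _].
by have [] := mvP hv hm.
Qed.

(** Inflow into mass at most [k] comes from mass at most [k.+1], so global balance is a finite
    identity. For invalid [eta] both sides are 0, as valid configurations never jump there. *)
Lemma balance_ball k eta : (mass eta <= k)%N ->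
  \sum_(eta' <- cball N k.+1 | eta' != eta) vpi eta' * rate eta' eta = vpi eta * exit eta.
Proof.
move=> hk; have [hv|hv] := pselect (valid sigma eta); last first.
  rewrite /vpi (asboolF hv) mul0r big1 // => e' _.
  case: ifPn => [/asboolP h'|]; rewrite ?mul0r // rate_eq0 ?mulr0 //; by left.
have [pi0 _ /(_ _ hv)] := pi_stat.
rewrite (@esum_finsupp _ _ _ (cball N k.+1)).
- rewrite sumEFin => -[]; rewrite /vpi (asboolT hv) => <-.
  rewrite big_mkcond [RHS]big_mkcond /=; apply: eq_bigr => e _.
  have -> : (e \in [set e | valid sigma e /\ e <> eta]) = (e != eta) && `[< valid sigma e >].
    apply/idP/idP => [/set_mem [h1 /eqP->]|/andP[/eqP h /asboolP h2]]; first by rewrite asboolT.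
    by apply/mem_set.
  by case: (e != eta); case: `[< _ >]; rewrite ?mul0r.
- exact: cball_uniq.
- by move=> e [h _]; rewrite lee_fin mulr_ge0 ?rate_ge0 ?pi0.
- move=> e [h _]; rewrite mem_cball -ltnNge => h2.
  by rewrite rate_eq0 ?mulr0 //; right; rewrite (leq_ltn_trans _ h2).
Qed.

(** Stationarity in weak form, for observables supported in a ball. The expectation uses a ball one
    level larger because a jump into the support may start at mass [k.+1]. *)
Lemma Eball_gen_eq0 k f : (forall eta, (k < mass eta)%N -> f eta = 0) ->
  Eball k.+1 (gen f) = 0.
Proof.
move=> f0.
(* The list of moves is regrouped by target, which brings in [rate] and [exit_rate]. *)
have genE eta' : gen f eta' =
    \sum_(eta <- cball N k | eta' != eta) f eta * rate eta' eta - f eta' * exit eta'.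
  have -> : gen f eta' = \sum_(m <- mv eta' | m.1 != eta') m.2 * f m.1 - f eta' * exit eta'.
    rewrite /gen /exit_rate mulr_sumr -sumrB [RHS]big_mkcond; apply: eq_bigr => m _.
    case: eqP => [->|_]; last by rewrite mulrBr [f _ * _]mulrC.
    by rewrite subrr mulr0.
  congr (_ - _); under [RHS]eq_bigr do rewrite /rate mulr_sumr.
  rewrite (exchange_big_dep xpredT) //= [LHS]big_mkcond.
  apply: eq_bigr => m _.
  have [hm|hm] := boolP (m.1 \in cball N k); last first.
    have -> : f m.1 = 0 by apply: f0; rewrite ltnNge -mem_cball.
    rewrite mulr0 if_same big_seq_cond big1 // => e /and3P[he _ /eqP h].
    by rewrite -h (negPf hm) in he.
  rewrite big_mkcond (bigD1_seq m.1) ?cball_uniq //= eqxx andbT big1 ?addr0.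
    by rewrite eq_sym mulrC.
  by move=> e /negPf h; rewrite eq_sym [m.1 == e]eq_sym h andbF.
rewrite (eq_Eball (G := fun eta' => \sum_(eta <- cball N k | eta' != eta) f eta * rate eta' eta
   - f eta' * exit eta')) // EballB /Eball.
under eq_bigr do rewrite mulr_sumr.
rewrite (exchange_big_dep xpredT) //=.
(* With the target fixed, balance turns its total inflow into its outflow, which is the term
   subtracted. *)
under eq_big_seq => e he.
  under eq_bigr do rewrite mulrCA.
  rewrite -mulr_sumr balance_ball; last by rewrite -mem_cball.
  over.
apply/eqP; rewrite subr_eq0; apply/eqP.
transitivity (Eball k (fun e => f e * exit e)).
  by apply: eq_bigr => e _; rewrite mulrCA.
rewrite -(Eball_trunc _ (leqnSn k)); apply: eq_Eball => e _ _.
by case: leqP => [_|/f0->]; rewrite ?mul1r // !mul0r.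
Qed.

Definition level k F : R := Eball k (fun e => (mass e == k)%:R * F e).
Definition flux k : R := level k up.

Lemma Eball_recr k F : Eball k.+1 F = Eball k F + level k.+1 F.
Proof.
rewrite -(Eball_trunc F (leqnSn k)) -EballD; apply: eq_Eball => e _ h.
rewrite -mulrDl -natrD; have -> : ((mass e <= k) + (mass e == k.+1))%N = 1%N.
  by move: h; rewrite -[(mass e <= k)%N]ltnS; case: (ltngtP (mass e) k.+1).
by rewrite mul1r.
Qed.

Lemma level_up k F : level k F = Eball k.+1 (fun e => (mass e == k)%:R * F e).
Proof.
rewrite /level -(Eball_trunc _ (leqnSn k)); apply: eq_Eball => e _ _.
by case: eqP => [->|]; rewrite ?leqnn ?mul1r // !mul0r mulr0.
Qed.

(** Weak stationarity applied to the indicator of mass at most [k]: only jumps across the cut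
    contribute. *)
Lemma flux_down k : flux k = level k.+1 down.
Proof.
have := @Eball_gen_eq0 k (fun e => (mass e <= k)%N%:R).
rewrite (@eq_Eball k.+1 _ (fun e => (mass e == k.+1)%:R * down e - (mass e == k)%:R * up e)).
  rewrite EballB -/(level k.+1 down) -level_up => h; apply/eqP.
  rewrite eq_sym -subr_eq0; apply/eqP; apply: h => e.
  by rewrite ltnNge => /negPf ->.
move=> e hv _; rewrite /gen /down_rate /up_rate !mulr_sumr -sumrB.
apply: eq_big_seq => m hm; have [_ h] := mvP hv hm.
have [->|/h[_ h1 h2]] := eqVneq m.2 0; first by rewrite !mul0r !mulr0 subrr.
rewrite trunc_jump //; ring.
Qed.

(** A product rule; by [trunc_jump] the second term lives on jumps across the cut. *)
Lemma gen_trunc k W eta :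
  gen (fun e => W e * (mass e <= k)%N%:R) eta =
  (mass eta <= k)%N%:R * gen W eta +
  \sum_(m <- mv eta) m.2 * W m.1 * ((mass m.1 <= k)%N%:R - (mass eta <= k)%N%:R).
Proof.
rewrite /gen mulr_sumr -big_split; apply: eq_bigr => m _ /=; ring.
Qed.

(** The expectation of [gen W] equals, up to sign, what jumps across the cut carry. There the target
    has mass at most [k.+1], so [W] is at most [c * k.+1]; the factor 2 counts the upward and the
    downward current, which are equal. *)
Lemma Eball_gen_le k W (c : R) : 0 <= c ->
  (forall e, 0 <= W e <= c * (mass e)%:R) ->
  `|Eball k (gen W)| <= 2 * c * (k.+1%:R * flux k).
Proof.
move=> c0 hW.
have := @Eball_gen_eq0 k (fun e => W e * (mass e <= k)%N%:R).
rewrite (@eq_Eball k.+1 _ _ (fun e _ _ => gen_trunc k W e)) EballD Eball_trunc // => h.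
have /h/eqP : forall e, (k < mass e)%N -> W e * (mass e <= k)%N%:R = 0.
  by move=> e; rewrite ltnNge => /negPf->; rewrite mulr0.
rewrite addr_eq0 => /eqP ->.
rewrite normrN.
apply: (@le_trans _ _ (Eball k.+1 (fun e => c * k.+1%:R *
  ((mass e == k.+1)%:R * down e + (mass e == k)%:R * up e)))).
  rewrite /Eball; apply: le_trans (ler_norm_sum _ _ _) _; apply: ler_sum => e _.
  rewrite normrM (ger0_norm (vpi_ge0 e)).
  have [->|hv] := vpi_validP e; first by rewrite !mul0r.
  rewrite ler_wpM2l ?vpi_ge0 //.
  rewrite /down_rate /up_rate !mulr_sumr -big_split mulr_sumr /=.
  apply: le_trans (ler_norm_sum _ _ _) _; rewrite big_seq [leRHS]big_seq.
  apply: ler_sum => m hm; have [m0 hm2] := mvP hv hm.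
  have [->|/hm2[_ h1 h2]] := eqVneq m.2 0; first by rewrite !mul0r normr0 !mulr0 addr0 mulr0.
  rewrite trunc_jump // !normrM (ger0_norm m0).
  have /andP[W0 Wc] := hW m.1; rewrite (ger0_norm W0).
  have -> : c * k.+1%:R * ((mass e == k.+1)%:R * (m.2 * (mass m.1 < mass e)%N%:R) +
     (mass e == k)%:R * (m.2 * (mass e < mass m.1)%N%:R)) =
     m.2 * ((c * k.+1%:R) * ((mass e == k.+1)%:R * (mass m.1 < mass e)%N%:R +
     (mass e == k)%:R * (mass e < mass m.1)%N%:R)) by ring.
  rewrite -mulrA ler_wpM2l //.
  have cW : (mass m.1 <= k.+1)%N -> W m.1 <= c * k.+1%:R.
    by move=> hh; apply: (le_trans Wc); rewrite ler_wpM2l // ler_nat.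
  have ck : 0 <= c * k.+1%:R by rewrite mulr_ge0.
  case: (eqVneq (mass e) k.+1) => [e1|e1].
    rewrite e1; have -> : (k.+1 == k) = false by lia.
    rewrite !mul0r subr0 addr0 mul1r; case: ltnP => hh; rewrite ?normr0 ?mulr0 //.
    by rewrite normr1 !mulr1 cW // ltnW.
  case: (eqVneq (mass e) k) => [e2|e2]; last by rewrite !mul0r subr0 addr0 normr0 !mulr0.
  rewrite !mul0r !mul1r sub0r add0r normrN; case: ltnP => hh; rewrite ?normr0 ?mulr0 //.
  by rewrite normr1 !mulr1 cW // -e2.
rewrite EballZ EballD -level_up -/(level k.+1 down) -flux_down /flux.
lra.
Qed.

Lemma Eball1_cvg : (fun k => Eball k (fun=> 1)) @ \oo --> (1 : R).
Proof.
have [_ p1 _] := pi_stat.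
have e1 : (\esum_(e in [set e | valid sigma e]) (pi e * 1)%:E = 1)%E.
  by rewrite -[RHS]p1; apply: eq_esum => e _; rewrite mulr1.
have h k : Eball k (fun=> 1) <= 1.
  by have := @Eball_le_esum k (fun=> 1) (fun _ _ => ler01); rewrite e1 lee_fin.
have [l] := @Eball_cvg (fun=> 1) 1 (fun _ _ => ler01) h.
by rewrite e1 => -[<-].
Qed.

Lemma Eball1_le1 k : Eball k (fun=> 1) <= 1.
Proof.
have [_ p1 _] := pi_stat.
rewrite -lee_fin -[leRHS]p1 (le_trans (@Eball_le_esum k (fun=> 1) (fun _ _ => ler01))) //.
by apply: le_esum => e _; rewrite mulr1.
Qed.

Lemma flux_ge0 k : 0 <= flux k.
Proof.
rewrite /flux /level /Eball; apply: sumr_ge0 => e _.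
have [->|hv] := vpi_validP e; first by rewrite mul0r.
rewrite !mulr_ge0 ?vpi_ge0 //.
exact: up_rate_ge0.
Qed.

(** Telescoping over levels: by [flux_down] losses at level [k.+1] cancel gains at level [k], and
    level 0 has no losses. *)
Lemma Eball_net k : Eball k (fun e => up e - down e) = flux k.
Proof.
elim: k => [|k IH].
  rewrite EballB /flux /level.
  rewrite [X in _ - X](_ : _ = 0).
    rewrite subr0; apply: eq_Eball => e _; rewrite leqn0 => ->; by rewrite mul1r.
  rewrite /Eball big_seq big1 // => e; rewrite mem_cball leqn0 => /eqP e0.
  by rewrite /down_rate big1 ?mulr0 // => m _; rewrite e0 mulr0.
rewrite Eball_recr IH flux_down /flux.
have -> : level k.+1 (fun e => up e - down e) = level k.+1 up - level k.+1 down.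
  by rewrite /level -EballB; apply: eq_Eball => e _ _; rewrite mulrBr.
ring.
Qed.

Lemma sum_flux n : \sum_(0 <= j < n.+1) flux j = Eball n up.
Proof.
elim: n => [|n IH]; last by rewrite big_nat_recr //= IH Eball_recr.
rewrite big_nat1 /flux /level; apply: eq_Eball => e _; rewrite leqn0 => ->.
by rewrite mul1r.
Qed.

Local Notation influx := (influx rhoL rhoR).
Local Notation bdocc e := (bdry N (fun x i => (occ e x i)%:R : R)).

Lemma influx_ge0 : 0 <= influx.
Proof. by apply: sumr_ge0 => i _; rewrite addr_ge0. Qed.

(** The truncated expectation of the mass drift is [flux k], which is nonnegative. *)
Lemma Eball_bdry k : Eball k (fun e => bdocc e) <= influx.
Proof.
have : 0 <= Eball k (fun e => influx * 1 - bdocc e).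
  rewrite -(@eq_Eball k (fun e => up e - down e)) ?Eball_net ?flux_ge0 // => e hv _.
  by rewrite gen_mass // gen_mass_bdry // mulr1.
rewrite EballB EballZ subr_ge0 => h; apply: (le_trans h).
by rewrite ler_piMr ?influx_ge0 ?Eball1_le1.
Qed.

(** The partial sums of [flux] are truncated expectations of the upward rate, bounded by
    [influx + influx * influx] through the boundary occupation. *)
Lemma weighted_flux_small (e : R) K : 0 < e -> exists2 k, (K <= k)%N & k.+1%:R * flux k < e.
Proof.
move=> e0; apply: (@harmonic_weight_small _ _ (influx + influx * influx)) => //;
  last exact: flux_ge0.
have h n : Eball n up <= influx + influx * influx.
  apply: (@le_trans _ _ (Eball n (fun e => influx * 1 + influx * bdocc e))).
    by apply: Eball_le => c hv; rewrite mulr1; apply: up_rate_le.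
  rewrite EballD !EballZ lerD // ?ler_wpM2l ?influx_ge0 ?Eball_bdry //.
  by rewrite ler_piMr ?influx_ge0 ?Eball1_le1.
case=> [|n]; last by rewrite sum_flux.
by rewrite big_geq // addr_ge0 // ?mulr_ge0 // influx_ge0.
Qed.

End Stationary.

(** * The linear system for the stationary means *)

Section DiscreteLaplacian.
Variable R : realType.

Definition lap (f : nat -> R) (x : nat) : R := f x.+1 - 2 * f x + f x.-1.

(** The values of [g] at 0 and [n.+1] in the boundary terms cancel those inside [lap g]. *)
Lemma sum_by_parts (f g : nat -> R) (n : nat) : (0 < n)%N ->
  \sum_(x <- iota 1 n.-1) (f x.+1 - f x) * (g x - g x.+1) =
  \sum_(x <- iota 1 n) f x * lap g x + f 1%N * (g 1%N - g 0%N) - f n * (g n.+1 - g n).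
Proof.
case: n => // n _; elim: n => [|n IH].
  by rewrite /= big_nil big_seq1 /lap /=; ring.
have iS m : iota 1 m.+1 = rcons (iota 1 m) m.+1.
  by rewrite -{1}[m.+1]addn1 iotaD cats1 add1n.
move: IH; rewrite -![_.+1.-1]/(_) (iS n.+1) (iS n) !big_rcons /= => ->.
rewrite /lap /=; ring.
Qed.

End DiscreteLaplacian.

(** * The operator of the mean equation and the Lyapunov estimate *)

Section Equation.
Variables (R : realType) (N : nat) (eps gam : R) (rhoL rhoR : bool -> R).
Hypothesis N_gt0 : (0 < N)%N.

(* The values of [n] at the ghost sites [0] and [N.+1] cancel. *)
Definition meanop (n : nat -> bool -> R) (x : nat) (i : bool) : R :=
  epsp eps i * lap (n^~ i) x + gam * (n x (~~ i) - n x i)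
  + (x == 1%N)%:R * (rhoL i - n 1%N i + epsp eps i * (n 1%N i - n 0%N i))
  + (x == N)%:R * (rhoR i - n N i - epsp eps i * (n N.+1 i - n N i)).

(** Indicator weights select one cell; summation by parts moves the difference from the weight onto
    [n]. *)
Lemma genW_occ n x i : (0 < x <= N)%N ->
  genW N eps gam rhoL rhoR (fun j y => ((y == x) && (j == i))%:R) n = meanop n x i.
Proof.
move=> hx; rewrite /genW /meanop.
set w := fun (j : bool) (y : nat) => ((y == x) && (j == i))%:R : R.
have f0 : false%:R = 0 :> R by [].
have hpick (F : nat -> R) : \sum_(y <- iota 1 N) (y == x)%:R * F y = F x.
  have xN : x \in iota 1 N by rewrite mem_iota; lia.
  rewrite (bigD1_seq x xN (iota_uniq _ _)) /=.
  by rewrite eqxx mul1r big1 ?addr0 // => y /negPf ->; rewrite mul0r.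
have bulk : \sum_(y <- iota 1 N.-1) \sum_(j <- layers)
      epsp eps j * (w j y.+1 - w j y) * (n y j - n y.+1 j) =
   epsp eps i * (lap (n^~ i) x + (1%N == x)%:R * (n 1%N i - n 0%N i)
       - (N == x)%:R * (n N.+1 i - n N i)).
  rewrite (eq_bigr (fun y => epsp eps i * (((y.+1 == x)%:R - (y == x)%:R) * (n y i - n y.+1 i)))).
    rewrite -mulr_sumr (sum_by_parts (fun y => (y == x)%:R) (n^~ i)) // hpick //.
  move=> y _; rewrite /layers !big_cons big_nil /w; clear w.
  by case: i => /=; rewrite ?andbT ?andbF ?f0; ring.
have switch : \sum_(y <- iota 1 N) \sum_(j <- layers) gam * n y j * (w (~~ j) y - w j y) =
    gam * (n x (~~ i) - n x i).
  rewrite -(hpick (fun y => gam * (n y (~~ i) - n y i))); apply: eq_bigr => y _.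
  rewrite /layers !big_cons big_nil /w; clear bulk w.
  by case: i => /=; rewrite ?andbT ?andbF ?f0; ring.
rewrite bulk switch /layers !big_cons big_nil /w ![x == _]eq_sym.
clear w bulk switch; by case: i => /=; rewrite ?andbT ?andbF ?f0; ring.
Qed.

(* This weight makes the drift grow like the number of particles even when [eps = 0]: the
   offset [1 / gam] transfers half of the drift [2] of layer 0 to layer 1. *)
Definition lyap (i : bool) (x : nat) : R := x%:R ^+ 2 + (if i then 0 else gam^-1).

(** Since the second difference of the square is 2, a particle in layer 0 has bulk drift [2 - 1],
    one in layer 1 has [2 * eps + 1]; both are at least 1. The negative remainders sit at the end
    sites and are absorbed by [bdry]. *)
Lemma genW_lyap n : 0 < gam -> 0 <= eps -> (forall x i, 0 <= n x i) ->
  (forall i, 0 <= rhoL i) -> (forall i, 0 <= rhoR i) ->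
  \sum_(x <- iota 1 N) \sum_(i <- layers) n x i <=
  genW N eps gam rhoL rhoR lyap n
    + ((1 + eps) * (2 * N%:R + 1) + N%:R ^+ 2 + gam^-1) * bdry N n.
Proof.
move=> g0 e0 n0 L0 R0; rewrite /genW.
have lapsq x : (0 < x)%N -> lap (fun y => y%:R ^+ 2 : R) x = 2.
  by case: x => // x _; rewrite /lap /= -!natr1; ring.
have gV : 0 <= gam^-1 by rewrite invr_ge0 ltW.
have bulk : \sum_(y <- iota 1 N.-1) \sum_(j <- layers)
      epsp eps j * (lyap j y.+1 - lyap j y) * (n y j - n y.+1 j) =
   \sum_(j <- layers) epsp eps j * (2 * \sum_(y <- iota 1 N) n y j + n 1%N j
       - (2 * N%:R + 1) * n N j).
  rewrite exchange_big; apply: eq_bigr => j _ /=.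
  rewrite (eq_bigr (fun y => epsp eps j *
    ((n y.+1 j - n y j) * (y%:R ^+ 2 - y.+1%:R ^+ 2 : R)))).
    rewrite -mulr_sumr (sum_by_parts (n^~ j) (fun y => y%:R ^+ 2)) //; congr (_ * _).
    rewrite mulr_sumr -!addrA; congr (_ + _).
      apply: eq_big_seq => y; rewrite mem_iota => hy; rewrite lapsq; [ring|lia].
    by rewrite -!natr1 /=; ring.
  by move=> y _; rewrite /lyap; ring.
have switch : \sum_(y <- iota 1 N) \sum_(j <- layers) gam * n y j * (lyap (~~ j) y - lyap j y) =
    \sum_(y <- iota 1 N) (n y true - n y false).
  apply: eq_bigr => y _; rewrite /layers !big_cons big_nil /lyap /=; field.
  exact: lt0r_neq0.
rewrite bulk switch sumrB.
have -> : \sum_(x <- iota 1 N) \sum_(i <- layers) n x i =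
  \sum_(x <- iota 1 N) n x false + \sum_(x <- iota 1 N) n x true.
  rewrite -big_split; apply: eq_bigr => x _.
  by rewrite /layers !big_cons big_nil addr0.
rewrite /bdry /layers !big_cons !big_nil /lyap /=.
have S0 i : 0 <= \sum_(x <- iota 1 N) n x i by exact: sumr_ge0.
move: (S0 true) (S0 false); set S1 := \sum_(x <- _) n x true.
set S2 := \sum_(x <- _) n x false => h1 h2.
move: (n0 1%N true) (n0 1%N false) (n0 N true) (n0 N false).
move: (L0 true) (L0 false) (R0 true) (R0 false).
set l1 := rhoL true; set l2 := rhoL false; set r1 := rhoR true; set r2 := rhoR false.
set a1 := n 1%N true; set a2 := n 1%N false; set b1 := n N true; set b2 := n N false.
have M1 : (1 : R) <= N%:R by rewrite ler1n.
set M := N%:R in M1 *.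
set v := gam^-1 in gV *.
have X (a b : R) : 0 <= a -> 0 <= b -> 0 <= a * b by exact: mulr_ge0.
have M0 : 0 <= M by lra.
have M2 : 1 <= M ^+ 2 by rewrite expr2; nra.
move=> p1 p2 p3 p4 q1 q2 q3 q4.
have Q : 0 <= M ^+ 2 by lra.
set Q2 := M ^+ 2 in M2 Q *.
rewrite expr1n -subr_ge0.
(* Nonnegative monomials listed so that the closing [lra] is linear in them. *)
have t1 := X _ _ e0 h1.
have t2 := X _ _ e0 q1.
have t3 := X _ _ (X _ _ e0 M0) q1.
have t4 := X _ _ (X _ _ e0 M0) q2.
have t5 := X _ _ (X _ _ e0 M0) q4.
have t5' := X _ _ (X _ _ e0 M0) q3.
have t6 := X _ _ M0 q1. have t7 := X _ _ M0 q2. have t8 := X _ _ M0 q3. have t9 := X _ _ M0 q4.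
have u1 := X _ _ gV q1. have u2 := X _ _ gV q2. have u3 := X _ _ gV q3. have u4 := X _ _ gV q4.
have s1 := X _ _ gV p2. have s2 := X _ _ gV p4.
have s3 := X _ _ Q p3. have s4 := X _ _ Q p4.
have k1 := X _ _ e0 q1. have k2 := X _ _ e0 q2. have k3 := X _ _ e0 q3. have k4 := X _ _ e0 q4.
have M3 : 0 <= Q2 - 1 by lra.
have j1 := X _ _ M3 q1. have j2 := X _ _ M3 q2.
lra.
Qed.

End Equation.

(** On a truncation the constant reservoir terms are multiplied by the probability [c k] of the
    ball, which tends to 1. *)
Lemma meanop_cvg (R : realType) N (eps gam : R) (rhoL rhoR : bool -> R)
    (n : nat -> nat -> bool -> R) (c : nat -> R) (t : nat -> bool -> R) (x : nat) (i : bool) :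
  (forall y j, n k y j @[k --> \oo] --> t y j) -> c @ \oo --> (1 : R) ->
  meanop N eps gam (fun j => rhoL j * c k) (fun j => rhoR j * c k) (n k) x i @[k --> \oo] -->
  meanop N eps gam rhoL rhoR t x i.
Proof.
move=> nt c1.
have -> : meanop N eps gam rhoL rhoR t x i =
    meanop N eps gam (fun j => rhoL j * 1) (fun j => rhoR j * 1) t x i.
  by rewrite /meanop !mulr1.
rewrite /meanop /lap.
have mul_cst (a : R) (f : nat -> R) (l : R) : f @ \oo --> l -> a * f k @[k --> \oo] --> a * l.
  by move=> fl; apply: cvgM; [exact: cvg_cst|exact: fl].
apply: cvgD; [apply: cvgD; [apply: cvgD|]|]; apply: (mul_cst).
- apply: cvgD; last exact: nt.
  apply: cvgB; [exact: nt|apply: (mul_cst); exact: nt].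
- apply: cvgB; exact: nt.
- apply: cvgD; last by apply: (mul_cst); apply: cvgB; exact: nt.
  apply: cvgB; [apply: (mul_cst); exact: c1|exact: nt].
- apply: cvgB; last by apply: (mul_cst); apply: cvgB; exact: nt.
  apply: cvgB; [apply: (mul_cst); exact: c1|exact: nt].
Qed.

(** * Removal of the truncation *)

Section MeanProfile.
Variables (R : realType) (N : nat) (sigma : int) (eps gam : R) (rhoL rhoR : bool -> R).
Hypothesis N_gt0 : (0 < N)%N.
Hypothesis sigmaP : sigma \in [:: -1; 0; 1].
Hypothesis eps_ge0 : 0 <= eps.
Hypothesis gam_gt0 : 0 < gam.
Hypothesis rhoL_ge0 : forall i, 0 <= rhoL i.
Hypothesis rhoR_ge0 : forall i, 0 <= rhoR i.
Hypothesis rhoL_le1 : sigma = -1 -> forall i, rhoL i <= 1.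
Hypothesis rhoR_le1 : sigma = -1 -> forall i, rhoR i <= 1.
Variable pi : config N -> R.
Hypothesis pi_stat : is_stationary sigma eps gam rhoL rhoR pi.
Implicit Types (eta : config N) (w : bool -> nat -> R) (x y : nat) (i j : bool).
Implicit Types (F G f W : config N -> R).

Local Notation mv := (moves sigma eps gam rhoL rhoR).
Local Notation gen := (gen sigma eps gam rhoL rhoR).
Local Notation up := (up_rate sigma eps gam rhoL rhoR).
Local Notation down := (down_rate sigma eps gam rhoL rhoR).
Local Notation rate := (rate sigma eps gam rhoL rhoR).
Local Notation exit := (exit_rate sigma eps gam rhoL rhoR).
Let mvP eta m := @movesP R N sigma eps gam rhoL rhoR N_gt0 sigmaP eps_ge0 gam_gt0
  rhoL_ge0 rhoR_ge0 rhoL_le1 rhoR_le1 eta m.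

Local Notation Eball := (Eball sigma pi).
Local Notation flux := (flux sigma eps gam rhoL rhoR pi).

Let E_gen_le k W (c : R) := @Eball_gen_le R N sigma eps gam rhoL rhoR N_gt0 sigmaP eps_ge0
  gam_gt0 rhoL_ge0 rhoR_ge0 rhoL_le1 rhoR_le1 pi pi_stat k W c.
Let flux_small (e : R) K := @weighted_flux_small R N sigma eps gam rhoL rhoR N_gt0 sigmaP eps_ge0
  gam_gt0 rhoL_ge0 rhoR_ge0 rhoL_le1 rhoR_le1 pi pi_stat e K.
Let E_bdry k := @Eball_bdry R N sigma eps gam rhoL rhoR N_gt0 sigmaP eps_ge0
  gam_gt0 rhoL_ge0 rhoR_ge0 rhoL_le1 rhoR_le1 pi pi_stat k.

(** The Lyapunov function grows at most linearly in the mass for fixed [N], so its truncation error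
    is a multiple of [k.+1%:R * flux k], while [Eball_bdry] bounds the boundary part. *)
Lemma Eball_mass_bounded : exists b : R, forall k, Eball k (fun e => (mass e)%:R) <= b.
Proof.
pose c : R := N%:R ^+ 2 + gam^-1.
pose C : R := (1 + eps) * (2 * N%:R + 1) + N%:R ^+ 2 + gam^-1.
have gV : 0 <= gam^-1 by rewrite invr_ge0 ltW.
have c0 : 0 <= c by rewrite addr_ge0 // exprn_ge0.
have C0 : 0 <= C.
  by rewrite !addr_ge0 // ?exprn_ge0 // mulr_ge0 // addr_ge0 // mulr_ge0.
have main k : Eball k (fun e => (mass e)%:R) <=
    2 * c * (k.+1%:R * flux k) + C * influx rhoL rhoR.
  have step : Eball k (fun e => (mass e)%:R) <=
     Eball k (fun e => gen (wsum (lyap gam)) e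
       + C * bdry N (fun x i => (occ e x i)%:R)).
    apply: (Eball_le pi_stat) => e _.
    rewrite gen_wsum // massE wsum_occ.
    under eq_bigr do under eq_bigr do rewrite mul1r.
    exact: genW_lyap.
  apply: (le_trans step).
  rewrite EballD EballZ lerD // ?ler_wpM2l // ?E_bdry //.
  apply: le_trans (ler_norm _) _; apply: E_gen_le => // e; apply/andP; split.
    apply: wsum_ge0 => j y _; rewrite addr_ge0 ?exprn_ge0 //; by case: j.
  apply: wsum_le => j y /andP[_ hy]; rewrite lerD //; last by case: j.
  by rewrite lerXn2r ?nnegrE // ler_nat.
exists (2 * c + C * influx rhoL rhoR) => k.
(* The error is controlled only at some levels, but these are arbitrarily high; monotonicity carries
   the bound down to [k]. *)
have [l kl hl] := flux_small k ltr01.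
have mono : Eball k (fun e => (mass e)%:R) <= Eball l (fun e => (mass e)%:R).
  exact: (Eball_mono pi_stat).
apply: (le_trans mono).
apply: le_trans (main l) _; rewrite lerD2r ler_piMr ?mulr_ge0 //.
exact: ltW.
Qed.

(** The truncated expectation of the generator on one occupation number converges to [meanop] of the
    means, and it is arbitrarily small at arbitrarily high levels; so its limit is 0. *)
Lemma stationary_mean_equation : exists t : nat -> bool -> R,
  (forall x i, theta sigma pi i x = (t x i)%:E) /\
  (forall x i, (0 < x <= N)%N -> meanop N eps gam rhoL rhoR t x i = 0).
Proof.
have [b hb] := Eball_mass_bounded.
have ht x i : {l : R | theta sigma pi i x = l%:E /\
    (fun k => Eball k (fun e => (occ e x i)%:R)) @ \oo --> l}.
  apply: cid.
  have [||l h1 h2] := @Eball_cvg R N sigma eps gam rhoL rhoR pi pi_stat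
    (fun e => (occ e x i)%:R) b; [by []| |by exists l].
  move=> k; apply: le_trans (hb k); apply: (Eball_le pi_stat) => e _.
  by rewrite ler_nat occ_le_mass.
pose t x i := sval (ht x i).
have tP x i : theta sigma pi i x = (t x i)%:E by have [] := svalP (ht x i).
have tc x i : (fun k => Eball k (fun e => (occ e x i)%:R)) @ \oo --> t x i.
  by have [] := svalP (ht x i).
exists t; split => // x i hx.
pose A k := Eball k (gen (wsum (fun j y => ((y == x) && (j == i))%:R))).
have Ac : A @ \oo --> meanop N eps gam rhoL rhoR t x i.
  have -> : A = fun k =>
    meanop N eps gam (fun i => rhoL i * Eball k (fun=> 1)) (fun i => rhoR i * Eball k (fun=> 1))
      (fun x i => Eball k (fun e => (occ e x i)%:R)) x i.
    apply/funext => k; rewrite /A (@eq_Eball _ _ _ _ k _ (fun e => meanop N eps gam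
       (fun i => rhoL i * 1) (fun i => rhoR i * 1) (fun x i => (occ e x i)%:R) x i)).
      by rewrite /meanop /lap !(EballB, EballD, EballZ).
    by move=> e _ _; rewrite gen_wsum // genW_occ // /meanop !mulr1.
  exact: (@meanop_cvg R N eps gam rhoL rhoR (fun k x i => Eball k (fun e => (occ e x i)%:R))
    (fun k => Eball k (fun=> 1)) t x i tc (Eball1_cvg pi_stat)).
apply/eqP/negPn/negP; rewrite -normr_gt0 => d0.
set d := `|_| in d0.
have /cvgrPdist_lt/(_ (d / 2)) := Ac.
rewrite divr_gt0 // => /(_ isT)[K _ hK].
(* [d / 4] because [Eball_gen_le] doubles the weighted flux, leaving the other [d / 2] to the
   convergence. *)
have [k Kk hk] := @flux_small (d / 4) K (divr_gt0 d0 (ltr0Sn _ 3)).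
have := hK k Kk; rewrite /=.
have : `|A k| <= 2 * 1 * (k.+1%:R * flux k).
  apply: E_gen_le => // e; rewrite -occE mul1r ler0n ler_nat /=.
  exact: occ_le_mass.
have := ler_normB (meanop N eps gam rhoL rhoR t x i - A k) (- A k).
rewrite opprK subrK normrN -/d; lra.
Qed.

End MeanProfile.

(** * Comparison *)

Section Comparison.
Variables (R : realType) (N : nat) (eps gam : R).
Hypothesis eps01 : 0 <= eps <= 1.
Hypothesis gam_gt0 : 0 < gam.
Implicit Types (v t u b : nat -> bool -> R) (rhoL rhoR : bool -> R).

Local Notation hom := (meanop N eps gam (fun=> 0) (fun=> 0)).

Lemma epsp01 i : 0 <= epsp eps i <= 1.
Proof. by case: i => //=; rewrite ler01 lexx. Qed.

(** At a cell carrying a positive maximum, diffusion and switching contribute at most 0, and at an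
    end site the cancellation of the ghost value leaves in addition [- v]. Strictness of the
    assumption avoids any propagation of the maximum to neighbours. *)
Lemma max_principle v :
  (forall x i, (0 < x <= N)%N -> 0 < hom v x i) ->
  forall x i, (0 < x <= N)%N -> v x i <= 0.
Proof.
move=> hv x i hx; have [c0 [_ c0x c0i]] := @cell_indE N x i hx.
pose c := [arg max_(c > c0) v c.1.+1 c.2]%O.
have cmax (d : 'I_N * bool) : v d.1.+1 d.2 <= v c.1.+1 c.2.
  by rewrite /c; case: arg_maxP => // m _ /(_ d isT).
have vmax y j : (0 < y <= N)%N -> v y j <= v c.1.+1 c.2.
  by move=> hy; have [d [_ <- <-]] := @cell_indE N y j hy.
apply: (le_trans (vmax x i hx)); rewrite leNgt; apply/negP => M0.
have cN : (0 < c.1.+1 <= N)%N by rewrite /= ltn_ord.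
have := hv c.1.+1 c.2 cN; apply/negP; rewrite -leNgt.
move: vmax M0 cN; move: (c.1.+1) (c.2) => z k vmax M0 zN.
have /andP[p0 p1] := epsp01 k; rewrite /meanop /lap; set p := epsp eps k in p0 p1 *.
have X (a a' : R) : 0 <= a -> a' <= 0 -> a * a' <= 0 by exact: mulr_ge0_le0.
have g := X _ _ (ltW gam_gt0) (_ : v z (~~ k) - v z k <= 0).
have {}g : gam * (v z (~~ k) - v z k) <= 0 by apply: g; rewrite subr_le0 vmax.
(* Four cases: a single site that is both ends, left end, right end, interior. *)
have [z1|z1] := eqVneq z 1%N; have [zN'|zN'] := eqVneq z N;
  rewrite ?mulr0n ?mulr1n ?mul0r ?mul1r ?addr0.
- have N1 : N = 1%N by lia.
  rewrite N1 z1 /= in g M0 *; lra.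
- have l : p * (v z.+1 k - v z k) <= 0 by apply: X; rewrite // subr_le0 vmax //; lia.
  rewrite z1 /= in l g M0 *. lra.
- have l : p * (v z.-1 k - v z k) <= 0 by apply: X; rewrite // subr_le0 vmax //; lia.
  rewrite -zN' /= in l g M0 *; lra.
- have l : p * (v z.-1 k - v z k) <= 0 by apply: X; rewrite // subr_le0 vmax //; lia.
  have l' : p * (v z.+1 k - v z k) <= 0 by apply: X; rewrite // subr_le0 vmax //; lia.
  lra.
Qed.

(** [hom] is the linear part of the affine operator, so the maximum principle applies to both signs
    of [t - u], minus [b]. *)
Lemma comparison rhoL rhoR t u b :
  (forall x i, (0 < x <= N)%N -> meanop N eps gam rhoL rhoR t x i = 0) ->
  (forall x i, (0 < x <= N)%N -> `|meanop N eps gam rhoL rhoR u x i| < - hom b x i) ->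
  forall x i, (0 < x <= N)%N -> `|t x i - u x i| <= b x i.
Proof.
move=> ht hu x i hx; rewrite ler_norml.
have h1 := @max_principle (fun x i => t x i - u x i - b x i).
have h2 := @max_principle (fun x i => u x i - t x i - b x i).
have e1 y j : hom (fun x i => t x i - u x i - b x i) y j =
  meanop N eps gam rhoL rhoR t y j - meanop N eps gam rhoL rhoR u y j - hom b y j.
  by rewrite /meanop /lap; ring.
have e2 y j : hom (fun x i => u x i - t x i - b x i) y j =
  meanop N eps gam rhoL rhoR u y j - meanop N eps gam rhoL rhoR t y j - hom b y j.
  by rewrite /meanop /lap; ring.
have {}h1 : t x i - u x i - b x i <= 0.
  apply: h1 => // y j hy; rewrite e1 ht //; have := hu y j hy; rewrite ltr_norml; lra.
have {}h2 : u x i - t x i - b x i <= 0.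
  apply: h2 => // y j hy; rewrite e2 ht //; have := hu y j hy; rewrite ltr_norml; lra.
lra.
Qed.

End Comparison.

Section Barrier.
Variables (R : realType) (N : nat).

(** A parabola vanishing at the ghost sites, scaled to stay in [0, 1] with constant second
    difference of order [N ^- 2]. *)
Definition hump (x : nat) : R := x%:R * (N.+1%:R - x%:R) / N.+1%:R ^+ 2.

Lemma hump01 x : (x <= N.+1)%N -> 0 <= hump x <= 1.
Proof.
move=> hx; have N0 : (0 : R) < N.+1%:R ^+ 2 by rewrite exprn_gt0.
have h0 : (0 : R) <= x%:R by [].
have h1 : (x%:R : R) <= N.+1%:R by rewrite ler_nat.
have -> : 0 <= hump x by rewrite /hump divr_ge0 ?(ltW N0) // mulr_ge0 // subr_ge0.
rewrite /hump /=.
by rewrite ler_pdivrMr // mul1r expr2; nra.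
Qed.

Lemma lap_hump x : (0 < x)%N -> lap hump x = - 2 / N.+1%:R ^+ 2.
Proof.
case: x => // x _; rewrite /lap /hump /= -!natr1; field.
by rewrite natr1 pnatr_eq0.
Qed.

Lemma hump0 : hump 0 = 0. Proof. by rewrite /hump !mul0r. Qed.
Lemma humpS : hump N.+1 = 0. Proof. by rewrite /hump subrr mulr0 mul0r. Qed.

End Barrier.

(** * Elementary estimates for the exponential and sinh *)

Section Sinh.
Variable R : realType.
Implicit Types a d s x y : R.

Lemma sinh_second_difference a d :
  sinh (a + d) - 2 * sinh a + sinh (a - d) = (expR d + expR (- d) - 2) * sinh a.
Proof. by rewrite /sinh !opprD opprK !expRD; field. Qed.

(** Only [1 + s <= expR s] at [s] and [- s] is used; as the two exponentials have product 1, it also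
    gives upper bounds. *)
Lemma expR_near0 s : 0 <= s <= 2^-1 -> `|expR s - expR (- s) - 2 * s| <= 2 * s ^+ 2.
Proof.
move=> /andP[s0 s1].
have a1 := expR_ge1Dx s; have a2 := expR_ge1Dx (- s).
have P : expR s * expR (- s) = 1 by rewrite -expRD subrr expR0.
have p1 := expR_gt0 s; have p2 := expR_gt0 (- s).
set a := expR s in a1 P p1 *; set b := expR (- s) in a2 P p2 *.
have ha : a * (1 - s) <= 1 by rewrite -[leRHS]P ler_wpM2l // ltW.
have hb : b * (1 + s) <= 1 by rewrite -[leRHS]P [a * b]mulrC ler_wpM2l // ltW.
have ub : a <= 1 + s + 2 * s ^+ 2 by rewrite expr2; nra.
have vb : b <= 1 - s + s ^+ 2 by rewrite expr2; nra.
have s2 : 0 <= s ^+ 2 by rewrite exprn_ge0.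
rewrite ler_norml. apply/andP; split; lra.
Qed.

Lemma cosh_near0 d : 0 <= d <= 1 ->
  `|expR d + expR (- d) - 2 - d ^+ 2| <= 2 * d ^+ 3.
Proof.
move=> /andP[d0 d1]; pose s := d / 2.
have hs : 0 <= s <= 2^-1 by rewrite /s; lra.
have -> : d = s + s by rewrite /s; field.
have h := expR_near0 hs; have P : expR s * expR (- s) = 1 by rewrite -expRD subrr expR0.
rewrite opprD !expRD; move: h P hs; set a := expR s; set b := expR (- s) => h P /andP[s0 s1].
(* With [d = 2 s] and [a b = 1] the left side is [(a - b)^2 - (2 s)^2], a difference of squares with
   one factor estimated by [expR_near0]. *)
have -> : a * a + b * b - 2 - (s + s) ^+ 2 =
    (a - b - 2 * s) * (a - b - 2 * s + 4 * s) + 2 * (a * b - 1).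
  by ring.
rewrite P subrr mulr0 addr0.
rewrite normrM; set q := a - b - 2 * s in h *.
have s2 : 0 <= s ^+ 2 by rewrite exprn_ge0.
have h2 : `|q + 4 * s| <= 5 * s.
  have hq : 2 * s ^+ 2 <= s by rewrite expr2; nra.
  by rewrite ler_norml; move: h; rewrite ler_norml; lra.
apply: (@le_trans _ _ (2 * s ^+ 2 * (5 * s))); first by rewrite ler_pM.
by rewrite -subr_ge0 !exprS expr0; nra.
Qed.

Lemma expR_lipschitz (M : R) x y : x <= M -> y <= M ->
  `|expR x - expR y| <= expR M * `|x - y|.
Proof.
wlog xy : x y / x <= y => [h hx hy|hx hy].
  by case: (leP x y) => [|/ltW] xy; last rewrite distrC (distrC x); exact: h.
have e0 := expR_gt0 y; have h := expR_ge1Dx (x - y).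
have e1 : expR x = expR y * expR (x - y) by rewrite -expRD addrC subrK.
have eM : expR y <= expR M by rewrite ler_expR.
rewrite distrC (distrC x) !ger0_norm ?subr_ge0 ?ler_expR //.
apply: (@le_trans _ _ (expR y * (y - x))); last by rewrite ler_wpM2r // subr_ge0.
by rewrite e1; nra.
Qed.

Lemma sinh_lipschitz (M : R) x y : 0 <= x <= M -> 0 <= y <= M ->
  `|sinh x - sinh y| <= expR M * `|x - y|.
Proof.
move=> /andP[x0 xM] /andP[y0 yM].
have h1 := expR_lipschitz xM yM.
have h2 : `|expR (- x) - expR (- y)| <= expR M * `|x - y|.
  have -> : `|x - y| = `|- x - - y| by rewrite -normrN; congr `|_|; ring.
  by apply: expR_lipschitz; lra.
have -> : sinh x - sinh y = 2^-1 * ((expR x - expR y) - (expR (- x) - expR (- y))).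
  by rewrite /sinh; ring.
rewrite normrM ger0_norm ?invr_ge0 //.
have := ler_normB (expR x - expR y) (expR (- x) - expR (- y)); lra.
Qed.

Lemma sinh_gt0 x : 0 < x -> 0 < sinh x.
Proof. by move=> x0; rewrite /sinh divr_gt0 // subr_gt0 ltr_expR; lra. Qed.

Lemma sinh_ge0 x : 0 <= x -> 0 <= sinh x.
Proof. by move=> x0; rewrite /sinh divr_ge0 // subr_ge0 ler_expR; lra. Qed.

Lemma ler_sinh x y : x <= y -> sinh x <= sinh y.
Proof.
move=> xy; rewrite /sinh ler_pM2r ?invr_gt0 // lerD // ?ler_expR //.
by rewrite lerN2 ler_expR; lra.
Qed.

Lemma sinh0 : sinh 0 = 0 :> R.
Proof. by rewrite /sinh oppr0 subrr mul0r. Qed.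

End Sinh.

(** * The diffusive case *)

Lemma inv_succ_small (R : realType) (c e : R) : 0 <= c -> 0 < e ->
  exists K, forall N, (K <= N)%N -> c / N.+1%:R <= e.
Proof.
move=> c0 e0; exists (Num.bound (c / e)) => N hN.
have h : c / e < N%:R.
  by rewrite (lt_le_trans (archi_boundP _)) ?ler_nat // divr_ge0 // ltW.
rewrite ler_pdivrMr // mulrC -ler_pdivrMr // -natr1; lra.
Qed.

(** Passing from [N ^ 2] to [(N + 1) ^ 2] costs [gam N * (2 N + 1)], which is of order [1 / N]. *)
Lemma rate_scaling (R : realType) (Ups : R) (gam : nat -> R) : 0 < Ups ->
  (forall N, (0 < N)%N -> 0 < gam N) ->
  (fun N : nat => gam N * N%:R ^+ 2) @ \oo --> Ups ->
  forall e, 0 < e -> exists K, forall N, (K <= N)%N ->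
    `|gam N - Ups / N.+1%:R ^+ 2| <= e / N.+1%:R ^+ 2.
Proof.
move=> U0 g0 hc e e0.
have /cvgrPdist_le/(_ (e / 2)) := hc; rewrite divr_gt0 // => /(_ isT)[K1 _ hK1].
(* This constant bounds [N * (gam N * (2 N + 1))]. The smallness is used at [N.-1], hence [K2.+1]
   below. *)
have a0 : 0 <= 2 * (Ups + e) * 2 by rewrite !mulr_ge0 // addr_ge0 ?ltW.
have b0 : 0 < e / 2 by rewrite divr_gt0.
have [K2 hK2] := inv_succ_small a0 b0.
exists (maxn 1 (maxn K1 K2.+1)) => N; rewrite !geq_max => /and3P[N0 NK1 NK2].
have g := g0 _ N0; have := hK1 N NK1; rewrite /= distrC => h1.
have := hK2 N.-1; rewrite prednK // => /(_ _) h2.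
have {}h2 : 2 * (Ups + e) * 2 / N%:R <= e / 2 by apply: h2; lia.
have n0 : (0 : R) < N%:R by rewrite ltr0n.
have n1 : (1 : R) <= N%:R by rewrite ler1n.
have S0 : (0 : R) < N.+1%:R ^+ 2 by rewrite exprn_gt0.
rewrite ler_pdivlMr // -[X in _ * X](ger0_norm (ltW S0)) -normrM mulrBl divfK ?gt_eqF //.
have -> : gam N * N.+1%:R ^+ 2 - Ups = (gam N * N%:R ^+ 2 - Ups) + gam N * (2 * N%:R + 1).
  by rewrite -natr1; ring.
have h3 : gam N * (2 * N%:R + 1) <= e / 2.
  apply: le_trans h2; rewrite ler_pdivlMr //.
  have : gam N * N%:R ^+ 2 <= Ups + e by move: h1; rewrite ler_norml; lra.
  rewrite expr2 => h4; have := mulr_ge0 (ltW g) (ltW n0); nra.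
have h4 : 0 <= gam N * (2 * N%:R + 1) by rewrite mulr_ge0 ?(ltW g) //; lra.
by move: h1; rewrite !ler_norml; lra.
Qed.

Lemma lap_affine (R : realType) (f : nat -> R) (c a b : R) x : (0 < x)%N ->
  lap (fun x => c * f x + (a * x%:R + b)) x = c * lap f x.
Proof. by case: x => // x _; rewrite /lap /= -[x.+2%:R]natr1 -[x.+1%:R]natr1; ring. Qed.

Section LimitProfile.
Variables (R : realType) (eps Ups rL0 rL1 rR0 rR1 : R).
Hypothesis eps01 : 0 < eps <= 1.
Hypothesis Ups_gt0 : 0 < Ups.

Local Notation rho := (rho_stat eps Ups rL0 rL1 rR0 rR1).
Local Notation Lam := (Lambda eps rL0 rL1 rR0 rR1).
Local Notation B := (Num.sqrt (Ups * (1 + eps^-1))).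
Local Notation rL := (fun i : bool => if i then rL1 else rL0).
Local Notation rR := (fun i : bool => if i then rR1 else rR0).

(* [rho_0 - rho_1], the only part of the profile that depends on [Ups]. *)
Definition gap (y : R) : R :=
  sinh (B * (1 - y)) / sinh B * (rL0 - rL1) + sinh (B * y) / sinh B * (rR0 - rR1).

Let eps_gt0 : 0 < eps. Proof. by case/andP: eps01. Qed.
Let eps_le1 : eps <= 1. Proof. by case/andP: eps01. Qed.

Let e_neq0 : eps != 0. Proof. exact: lt0r_neq0. Qed.
Let e1_neq0 : 1 + eps != 0. Proof. by apply: lt0r_neq0; rewrite addr_gt0. Qed.

Let B_gt0 : 0 < B.
Proof. by rewrite sqrtr_gt0 mulr_gt0 // addr_gt0 // invr_gt0. Qed.

(** This choice of [B] makes the discrete eigenvalue match the switching rate to leading order. *)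
Let B2 : eps / (1 + eps) * B ^+ 2 = Ups.
Proof.
rewrite sqr_sqrtr; last by rewrite mulr_ge0 ?(ltW Ups_gt0) // addr_ge0 // invr_ge0 ltW.
by field; rewrite ?e1_neq0 ?e_neq0.
Qed.

(** The two weights of [gap] differ by 1, so [gap] is indeed the difference of the layers. *)
Lemma rho_stat_gap i y :
  rho i y = (if i then - (1 + eps)^-1 else eps / (1 + eps)) * gap y + Lam y.
Proof. by rewrite /rho_stat /gap; case: i; ring. Qed.

Lemma gap0 : gap 0 = rL0 - rL1.
Proof. by rewrite /gap subr0 mulr1 mulr0 sinh0 divff ?gt_eqF ?sinh_gt0 //; ring. Qed.

Lemma gap1 : gap 1 = rR0 - rR1.
Proof. by rewrite /gap subrr mulr1 mulr0 sinh0 divff ?gt_eqF ?sinh_gt0 //; ring. Qed.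

Lemma rho_stat0 i : rho i 0 = rL i.
Proof. by rewrite rho_stat_gap gap0 /Lambda; case: i; field; rewrite ?e1_neq0 ?e_neq0. Qed.

Lemma rho_stat1 i : rho i 1 = rR i.
Proof. by rewrite rho_stat_gap gap1 /Lambda; case: i; field; rewrite ?e1_neq0 ?e_neq0. Qed.

Lemma gap_bounded y : 0 <= y <= 1 -> `|gap y| <= `|rL0 - rL1| + `|rR0 - rR1|.
Proof.
move=> /andP[y0 y1]; have s0 := sinh_gt0 B_gt0.
have frac z : 0 <= z <= 1 -> `|sinh (B * z) / sinh B| <= 1.
  move=> /andP[z0 z1]; have h0 : 0 <= B * z by rewrite mulr_ge0 // ltW.
  rewrite ger0_norm; last by rewrite divr_ge0 ?sinh_ge0 // ltW.
  by rewrite ler_pdivrMr // mul1r ler_sinh // ler_piMr // ltW.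
rewrite /gap; apply: (le_trans (ler_normD _ _)); apply: lerD.
  by rewrite normrM ler_piMl // frac //; lra.
by rewrite normrM ler_piMl // frac //; lra.
Qed.

Lemma gap_lipschitz : exists2 L : R, 0 <= L & forall y z, 0 <= y <= 1 -> 0 <= z <= 1 ->
  `|gap y - gap z| <= L * `|y - z|.
Proof.
have b0 := ltW B_gt0.
pose M := expR B * B.
have M0 : 0 <= M by rewrite mulr_ge0 // expR_ge0.
exists (M * `|(rL0 - rL1) / sinh B| + M * `|(rR0 - rR1) / sinh B|).
  by rewrite addr_ge0 ?mulr_ge0.
move=> y z hy hz.
have bd w : 0 <= w <= 1 -> 0 <= B * w <= B.
  by move=> /andP[w0 w1]; rewrite mulr_ge0 //= ler_piMr.
have lip v w : 0 <= v <= 1 -> 0 <= w <= 1 ->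
    `|sinh (B * v) - sinh (B * w)| <= M * `|v - w|.
  move=> hv hw; apply: le_trans (sinh_lipschitz (bd _ hv) (bd _ hw)) _.
  by rewrite -mulrBr normrM (ger0_norm b0) mulrA.
have -> : gap y - gap z =
    (sinh (B * (1 - y)) - sinh (B * (1 - z))) * ((rL0 - rL1) / sinh B)
    + (sinh (B * y) - sinh (B * z)) * ((rR0 - rR1) / sinh B).
  by rewrite /gap; ring.
apply: le_trans (ler_normD _ _) _; rewrite !normrM mulrDl lerD //.
- rewrite mulrAC ler_wpM2r //; apply: le_trans (lip _ _ _ _) _; [lra|lra|].
  have -> : 1 - y - (1 - z) = - (y - z) by ring.
  by rewrite normrN.
- by rewrite mulrAC ler_wpM2r // lip.
Qed.

Lemma rho_stat_lipschitz : exists2 L : R, 0 <= L & forall i y z, 0 <= y <= 1 -> 0 <= z <= 1 ->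
  `|rho i y - rho i z| <= L * `|y - z|.
Proof.
have [L L0 hL] := gap_lipschitz.
pose c : R := (1 + eps)^-1 * (rR0 - rL0) + eps / (1 + eps) * (rR1 - rL1).
have P1 : 0 < 1 + eps by rewrite addr_gt0.
have V1 : (1 + eps)^-1 <= 1 by rewrite invf_le1 // lerDl ltW.
have V0 : 0 <= (1 + eps)^-1 by rewrite invr_ge0 ltW.
exists (L + `|c|); first by rewrite addr_ge0.
move=> i y z hy hz; have h := hL y z hy hz.
have -> : rho i y - rho i z =
    (if i then - (1 + eps)^-1 else eps / (1 + eps)) * (gap y - gap z) + c * (y - z).
  by rewrite !rho_stat_gap /Lambda /c; ring.
apply: le_trans (ler_normD _ _) _; rewrite !normrM mulrDl lerD //.
apply: le_trans h; rewrite ler_piMl //.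
case: i; first by rewrite normrN ger0_norm.
rewrite ger0_norm; last by rewrite mulr_ge0 // ltW.
by rewrite mulr_ile1 // ltW.
Qed.

Lemma lap_gap (h : R) x : (0 < x)%N ->
  lap (fun x => gap (x%:R * h)) x =
  (expR (B * h) + expR (- (B * h)) - 2) * gap (x%:R * h).
Proof.
case: x => // x _; rewrite /lap /=.
have d1 := sinh_second_difference (B * (1 - x.+1%:R * h)) (B * h).
have d2 := sinh_second_difference (B * (x.+1%:R * h)) (B * h).
have e1 : B * (1 - x.+1%:R * h) + B * h = B * (1 - x%:R * h) by rewrite -natr1; ring.
have e2 : B * (1 - x.+1%:R * h) - B * h = B * (1 - x.+2%:R * h) by rewrite -!natr1; ring.
have e3 : B * (x.+1%:R * h) + B * h = B * (x.+2%:R * h) by rewrite -!natr1; ring.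
have e4 : B * (x.+1%:R * h) - B * h = B * (x%:R * h) by rewrite -!natr1; ring.
rewrite e1 e2 in d1; rewrite e3 e4 in d2; rewrite /gap.
move: d1 d2; move: (sinh (B * (1 - x%:R * h))) (sinh (B * (1 - x.+1%:R * h)))
  (sinh (B * (1 - x.+2%:R * h))) (sinh (B * (x%:R * h))) (sinh (B * (x.+1%:R * h)))
  (sinh (B * (x.+2%:R * h))) => a0 a1 a2 c0 c1 c2 d1 d2.
have -> : a2 = (expR (B * h) + expR (- (B * h)) - 2) * a1 + 2 * a1 - a0 by rewrite -d1; ring.
have -> : c2 = (expR (B * h) + expR (- (B * h)) - 2) * c1 + 2 * c1 - c0 by rewrite -d2; ring.
ring.
Qed.

(** [Lam] is affine, so only [gap] feels the Laplacian. Diffusivity times the weight of [gap] is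
    [eps / (1 + eps)] up to sign in both layers, which gives one common factor. *)
Lemma rho_stat_bulk (g h : R) x i : (0 < x)%N ->
  epsp eps i * lap (fun x => rho i (x%:R * h)) x
    + g * (rho (~~ i) (x%:R * h) - rho i (x%:R * h)) =
  (if i then -1 else 1) * gap (x%:R * h)
    * (eps / (1 + eps) * (expR (B * h) + expR (- (B * h)) - 2) - g).
Proof.
move=> x0; set k := expR _ + _ - 2.
have -> : lap (fun x => rho i (x%:R * h)) x =
    (if i then - (1 + eps)^-1 else eps / (1 + eps)) * (k * gap (x%:R * h)).
  rewrite -lap_gap // -(lap_affine _ _
    (((1 + eps)^-1 * (rR0 - rL0) + eps / (1 + eps) * (rR1 - rL1)) * h)
    ((1 + eps)^-1 * rL0 + eps / (1 + eps) * rL1)) //.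
  by congr lap; apply/funext => y; rewrite rho_stat_gap /Lambda; ring.
by rewrite !rho_stat_gap; case: i => /=; field; rewrite ?e1_neq0 ?e_neq0.
Qed.

Lemma mean_profile_close (gam : nat -> R) : (forall N, (0 < N)%N -> 0 < gam N) ->
  (fun N : nat => gam N * N%:R ^+ 2) @ \oo --> Ups ->
  forall e : R, 0 < e -> exists K, forall N, (K <= N)%N -> forall t : nat -> bool -> R,
    (forall x i, (0 < x <= N)%N -> meanop N eps (gam N) rL rR t x i = 0) ->
    forall x i, (0 < x <= N)%N -> `|t x i - rho i (x%:R / N.+1%:R)| <= e.
Proof.
move=> g0 hc e e0.
have [L L0 hL] := rho_stat_lipschitz.
pose D := `|rL0 - rL1| + `|rR0 - rR1|.
have D0 : 0 <= D by rewrite addr_ge0.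
pose C := e / 2; have C0 : 0 < C by rewrite divr_gt0.
have Ce0 : 0 < C * eps by rewrite mulr_gt0.
(* Chosen so that the error of the switching rate, times the bound [D] on [gap], stays below
   [C * eps / 2]; [K4] bounds the cosh remainder by [C * eps], and the barrier provides
   [2 * C * eps], all in units of [h ^+ 2]. *)
pose q := C * eps / (2 * (D + 1)).
have q0 : 0 < q by rewrite divr_gt0 // mulr_gt0 //; lra.
have b0 := ltW B_gt0.
have [K1 hK1] := rate_scaling Ups_gt0 g0 hc q0.
have [K2 hK2] := inv_succ_small L0 C0.
have [K3 hK3] := inv_succ_small b0 ltr01.
have DB0 : 0 <= D * (2 * B ^+ 3) by rewrite !mulr_ge0 ?exprn_ge0.
have [K4 hK4] := inv_succ_small DB0 Ce0.
exists (maxn 1 (maxn (maxn K1 K2) (maxn K3 K4))) => N.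
rewrite !geq_max => /and3P[N0 /andP[NK1 NK2] /andP[NK3 NK4]] t ht.
pose h : R := N.+1%:R^-1; have h0 : 0 < h by rewrite invr_gt0.
pose u (x : nat) (i : bool) := rho i (x%:R * h).
(* The constant dominates the boundary residual, the parabola the bulk residual; together they stay
   below [e]. *)
pose b (x : nat) (i : bool) := C + C * hump R N x.
have S0 : (0 : R) < N.+1%:R by [].
have xh x : (x <= N.+1)%N -> 0 <= x%:R * h <= 1.
  by move=> hx; rewrite mulr_ge0 ?(ltW h0) //= ler_pdivrMr // mul1r ler_nat.
have ub (x : nat) i : (0 < x <= N)%N -> `|t x i - u x i| <= b x i.
  move: x i; have e01 : 0 <= eps <= 1 by rewrite (ltW eps_gt0).
  apply: (comparison e01 (g0 _ N0) ht) => x i hx.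
  have x0 : (0 < x)%N by case/andP: hx.
  rewrite {1}/meanop rho_stat_bulk //.
  have /andP[p0 p1] := epsp01 e01 i.
  have pe : eps <= epsp eps i by case: (i) => //=.
  set p := epsp eps i in p0 p1 pe *.
  have u0 : u 0%N i = rL i by rewrite /u mul0r rho_stat0.
  have uN : u N.+1 i = rR i by rewrite /u divff ?gt_eqF // rho_stat1.
  have step y : (y <= N)%N -> `|u y.+1 i - u y i| <= C.
    move=> hy; have hh : y.+1%:R * h - y%:R * h = h by rewrite -natr1; ring.
    have y1 : (y.+1 <= N.+1)%N by rewrite ltnS.
    have := hL i _ _ (xh _ y1) (xh _ (ltnW y1)).
    rewrite hh (gtr0_norm h0) => /le_trans; apply; exact: hK2.
  (* The profile takes the reservoir values at the ghost sites, so the boundary residual is [1 - p]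
     times one increment, of order [h]. *)
  have bdL : `|rL i - u 1%N i + p * (u 1%N i - u 0%N i)| <= C.
    have -> : rL i - u 1%N i + p * (u 1%N i - u 0%N i) = - ((1 - p) * (u 1%N i - u 0%N i)).
      by rewrite -u0; ring.
    rewrite normrN normrM ger0_norm ?subr_ge0 //; apply: le_trans (step 0%N _) => //.
    by rewrite ler_piMl //; lra.
  have bdR : `|rR i - u N i - p * (u N.+1 i - u N i)| <= C.
    have -> : rR i - u N i - p * (u N.+1 i - u N i) = (1 - p) * (u N.+1 i - u N i).
      by rewrite -uN; ring.
    rewrite normrM ger0_norm ?subr_ge0 //; apply: le_trans (step N _) => //.
    by rewrite ler_piMl //; lra.
  set A1 := rL i - _ + _ in bdL *; set A2 := rR i - _ - _ in bdR *.
  set A0 := _ * (_ - gam N).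
  have h2 : 0 < h ^+ 2 by rewrite exprn_gt0.
  have A0b : `|A0| < 2 * C * eps * h ^+ 2.
    have Bh : 0 <= B * h <= 1 by rewrite mulr_ge0 ?(ltW h0) //= hK3.
    have k1 := cosh_near0 Bh.
    have := hK1 N NK1; rewrite -exprVn -/h => k2.
    have qe0 : 0 <= eps / (1 + eps) by rewrite divr_ge0 //; lra.
    have qe1 : eps / (1 + eps) <= 1 by rewrite ler_pdivrMr; lra.
    have k3 : `|eps / (1 + eps) * (expR (B * h) + expR (- (B * h)) - 2) - gam N|
        <= (2 * B ^+ 3 * h + q) * h ^+ 2.
      have -> : eps / (1 + eps) * (expR (B * h) + expR (- (B * h)) - 2) - gam N =
         eps / (1 + eps) * (expR (B * h) + expR (- (B * h)) - 2 - (B * h) ^+ 2)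
         - (gam N - Ups * h ^+ 2).
        have -> : Ups * h ^+ 2 = eps / (1 + eps) * B ^+ 2 * h ^+ 2 by rewrite B2.
        ring.
      apply: le_trans (ler_normB _ _) _; rewrite mulrDl lerD //.
      rewrite normrM ger0_norm //.
      have -> : 2 * B ^+ 3 * h * h ^+ 2 = 2 * (B * h) ^+ 3 by ring.
      by apply: le_trans k1; rewrite ler_piMl.
    have gb : `|(if i then -1 else 1) * gap (x%:R * h)| <= D.
      have i1 : `|(if i then -1 else 1) : R| = 1 by case: (i); rewrite ?normrN normr1.
      by rewrite normrM i1 mul1r; apply/gap_bounded/xh; case/andP: hx => _ /leq_trans; apply.
    rewrite /A0 normrM; apply: (@le_lt_trans _ _ (D * ((2 * B ^+ 3 * h + q) * h ^+ 2))).
      exact: ler_pM.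
    rewrite mulrA ltr_pM2r //.
    have := hK4 N NK4; rewrite -/h => k4.
    have k5 : D * q <= C * eps / 2.
      have -> : C * eps / 2 = (D + 1) * q by rewrite /q; field; apply: lt0r_neq0; lra.
      by rewrite ler_wpM2r ?(ltW q0) //; lra.
    rewrite mulrDr mulrA; lra.
  have -> : meanop N eps (gam N) (fun=> 0) (fun=> 0) b x i =
     - (2 * C * p * h ^+ 2) + (x == 1%N)%:R * (- b 0%N i - (1 - p) * (b 1%N i - b 0%N i))
     + (x == N)%:R * (- b N.+1 i + (1 - p) * (b N.+1 i - b N i)).
    rewrite /meanop -/p.
    have -> : lap (b^~ i) x = C * lap (hump R N) x by rewrite /lap /b; ring.
    rewrite lap_hump // -exprVn -/h /b; ring.
  have bL : - b 0%N i - (1 - p) * (b 1%N i - b 0%N i) <= - C.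
    rewrite /b hump0 mulr0 addr0.
    have /andP[j0 _] := @hump01 R N 1%N isT.
    have := mulr_ge0 (_ : 0 <= 1 - p) (mulr_ge0 (ltW C0) j0); rewrite subr_ge0 => /(_ p1).
    lra.
  have bR : - b N.+1 i + (1 - p) * (b N.+1 i - b N i) <= - C.
    rewrite /b humpS mulr0 addr0.
    have /andP[j0 _] := @hump01 R N N (leqnSn N).
    have := mulr_ge0 (_ : 0 <= 1 - p) (mulr_ge0 (ltW C0) j0); rewrite subr_ge0 => /(_ p1).
    lra.
  move: bL bR; set c1 := _ - _ * _; set c2 := - b N.+1 i + _ => bL bR.
  have pe2 : 2 * C * eps * h ^+ 2 <= 2 * C * p * h ^+ 2.
    by rewrite ler_wpM2r ?(ltW h2) // ler_wpM2l // mulr_ge0 // ltW.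
  have i1 : 0 <= (x == 1%N)%:R :> R by [].
  have i2 : 0 <= (x == N)%:R :> R by [].
  apply: le_lt_trans (ler_normD _ _) _; apply: le_lt_trans (lerD (ler_normD _ _) (lexx _)) _.
  rewrite [`|_ * A1|]normrM [`|_ * A2|]normrM (ger0_norm i1) (ger0_norm i2).
  have := ler_wpM2l i1 bdL; have := ler_wpM2l i2 bdR.
  have := ler_wpM2l i1 bL; have := ler_wpM2l i2 bR.
  lra.
move=> x i hx; apply: le_trans (ub x i hx) _; rewrite /b.
have /andP[_ j1] := @hump01 R N x (leq_trans (proj2 (andP hx)) (leqnSn N)).
have : C * hump R N x <= C by rewrite ler_piMr // ltW.
rewrite /C; lra.
Qed.

End LimitProfile.

(** * The case of a blocked second layer *)

(** The end sites are excluded because there layer 1 exchanges with its own reservoir at order 1,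
    against switching of order [N ^- 2]. *)
Lemma blocked_mean_profile_close (R : realType) (Ups : R) (rL rR : bool -> R) (gam : nat -> R) :
  0 < Ups -> (forall N, (0 < N)%N -> 0 < gam N) ->
  (fun N : nat => gam N * N%:R ^+ 2) @ \oo --> Ups ->
  forall e : R, 0 < e -> exists K, forall N, (K <= N)%N -> forall t : nat -> bool -> R,
    (forall x i, (0 < x <= N)%N -> meanop N 0 (gam N) rL rR t x i = 0) ->
    forall x i, (1 < x < N)%N ->
      `|t x i - (rL false + (rR false - rL false) * (x%:R / N.+1%:R))| <= e.
Proof.
move=> U0 g0 hc e e0.
pose M := `|rL false| + `|rL true| + `|rR false| + `|rR true|.
have M0 : 0 <= M by rewrite !addr_ge0.
pose C := e / 3; have C0 : 0 < C by rewrite divr_gt0.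
(* Makes [d + d * (2 / Ups)] equal to [C], so the barrier is at most [2 * C] away from the ends. *)
pose d := C / (1 + 2 / Ups).
have UV : 0 < 2 / Ups by rewrite divr_gt0.
have d0 : 0 < d by rewrite divr_gt0 // addr_gt0.
have U20 : 0 < Ups / 2 by rewrite divr_gt0.
have [K1 hK1] := rate_scaling U0 g0 hc U20.
have MU0 : 0 <= M * (2 * Ups) by rewrite !mulr_ge0 // ltW.
have [K2 hK2] := inv_succ_small MU0 C0.
exists (maxn 1 (maxn K1 K2)) => N; rewrite !geq_max => /and3P[N0 NK1 NK2] t ht.
pose h : R := N.+1%:R^-1; have h0 : 0 < h by rewrite invr_gt0.
have h1 : h <= 1 by rewrite invf_le1 // ler1n.
have h2 : 0 < h ^+ 2 by rewrite exprn_gt0.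
have gN := g0 _ N0; have gV : 0 < (gam N)^-1 by rewrite invr_gt0.
have := hK1 N NK1; rewrite -exprVn -/h ler_norml => /andP[k1 k2].
have gMC : gam N * M <= C.
  apply: le_trans (hK2 N NK2); rewrite -/h mulrC -mulrA ler_wpM2l //.
  have hh : h ^+ 2 <= h by rewrite expr2 ler_piMr // ltW.
  have := ler_wpM2l (ltW U0) hh; lra.
have hgU : h ^+ 2 / gam N <= 2 / Ups.
  by rewrite ler_pdivrMr // mulrAC ler_pdivlMr //; lra.
pose u (x : nat) (_ : bool) := rL false + (rR false - rL false) * (x%:R * h).
(* The offset [d * (h ^+ 2 / gam N)] gives layer 1 the drift [- d * h ^+ 2] by switching and costs
   layer 0 as much, half of what the parabola supplies. The [M] terms absorb the reservoir mismatch
   of layer 1; their cost [gam N * M] in layer 0 is paid by [C]. *)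
pose b (x : nat) (i : bool) := C + d * hump R N x
  + (if i then d * (h ^+ 2 / gam N) + M * ((x == 1%N)%:R + (x == N)%:R) else 0).
have b1 : d * (h ^+ 2 / gam N) * gam N = d * h ^+ 2 by field; exact: lt0r_neq0.
have ub (x : nat) i : (0 < x <= N)%N -> `|t x i - u x i| <= b x i.
  move: x i; have e01 : 0 <= (0 : R) <= (1 : R) by rewrite lexx ler01.
  apply: (comparison e01 gN ht) => x i hx; have x0 : (0 < x)%N by case/andP: hx.
  have lu : lap (u^~ i) x = 0.
    case: (x) x0 => // y _; rewrite /lap /u /= -[y.+2%:R]natr1 -[y.+1%:R]natr1; ring.
  have i1 : 0 <= (x == 1%N)%:R :> R by [].
  have i2 : 0 <= (x == N)%:R :> R by [].
  have dh : 0 < d * h ^+ 2 by rewrite mulr_gt0.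
  case: i lu => lu; rewrite {1}/meanop lu.
    (* [u] is a convex combination of the two reservoir values of layer 0. *)
    have uM y : (y <= N.+1)%N -> forall r, r = rL true \/ r = rR true -> `|r - u y true| <= M.
      move=> hy r hr.
      have y01 : 0 <= y%:R * h <= 1.
        by rewrite mulr_ge0 ?(ltW h0) //= ler_pdivrMr // mul1r ler_nat.
      move: y01; rewrite /u; set z := _ * h => /andP[z0 z1].
      have -> : rL false + (rR false - rL false) * z = (1 - z) * rL false + z * rR false by ring.
      apply: le_trans (ler_normB _ _) _.
      have a1 : `|(1 - z) * rL false| <= `|rL false|.
        by rewrite normrM ger0_norm ?subr_ge0 // ler_piMl //; lra.
      have a2 : `|z * rR false| <= `|rR false| by rewrite normrM ger0_norm // ler_piMl.
      have a3 := ler_normD ((1 - z) * rL false) (z * rR false).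
      have n1 := normr_ge0 (rL true); have n2 := normr_ge0 (rR true).
      by rewrite /M; case: hr => ->; lra.
    have e1 := uM 1%N isT _ (or_introl erefl).
    have e2 := uM N (leqnSn N) _ (or_intror erefl).
    have -> : epsp 0 true * 0 + gam N * (u x (~~ true) - u x true)
      + (x == 1%N)%:R * (rL true - u 1%N true + epsp 0 true * (u 1%N true - u 0%N true))
      + (x == N)%:R * (rR true - u N true - epsp 0 true * (u N.+1 true - u N true)) =
      (x == 1%N)%:R * (rL true - u 1%N true) + (x == N)%:R * (rR true - u N true) :> R.
      by rewrite /u /=; ring.
    apply: le_lt_trans (ler_normD _ _) _; rewrite !normrM (ger0_norm i1) (ger0_norm i2).
    have c1 := ler_wpM2l i1 e1; have c2 := ler_wpM2l i2 e2.
    have bM y : (y <= N)%N -> (y == 1%N) || (y == N) -> M <= b y true.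
      move=> hy hyy; have /andP[j0 _] := @hump01 R N y (leq_trans hy (leqnSn N)).
      rewrite /b.
      have s1 : 0 <= d * hump R N y by rewrite mulr_ge0 // ltW.
      have s2 : 0 <= d * (h ^+ 2 / gam N) := mulr_ge0 (ltW d0) (divr_ge0 (ltW h2) (ltW gN)).
      have s3 : M <= M * ((y == 1%N)%:R + (y == N)%:R).
        rewrite -[leLHS]mulr1 ler_wpM2l // -natrD ler1n.
        by rewrite addn_gt0; case/orP: hyy => ->; rewrite ?orbT.
      lra.
    have d1 := ler_wpM2l i1 (bM 1%N N0 isT).
    have d2 : (x == N)%:R * M <= (x == N)%:R * b N true.
      by apply: ler_wpM2l => //; apply: bM => //; rewrite eqxx orbT.
    have -> : meanop N 0 (gam N) (fun=> 0) (fun=> 0) b x true =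
      - (d * h ^+ 2) - gam N * M * ((x == 1%N)%:R + (x == N)%:R)
      - (x == 1%N)%:R * b 1%N true - (x == N)%:R * b N true.
      rewrite /meanop -b1 [b x (~~ true)]/b [b x true]/b /=.
      move: (b 1%N true) (b N true) (b 0%N true) (b N.+1 true) => z1 z2 z3 z4; ring.
    have gM : 0 <= gam N * M by rewrite mulr_ge0 // ltW.
    have := mulr_ge0 gM (addr_ge0 i1 i2); lra.
  have -> : epsp 0 false * 0 + gam N * (u x (~~ false) - u x false)
      + (x == 1%N)%:R * (rL false - u 1%N false + epsp 0 false * (u 1%N false - u 0%N false))
      + (x == N)%:R * (rR false - u N false - epsp 0 false * (u N.+1 false - u N false)) = 0 :> R.
    by rewrite /u /= divff ?pnatr_eq0 //; ring.
  have -> : meanop N 0 (gam N) (fun=> 0) (fun=> 0) b x false =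
      - (d * h ^+ 2) + (gam N * M - C) * ((x == 1%N)%:R + (x == N)%:R).
    rewrite /meanop.
    have -> : lap (b^~ false) x = d * lap (hump R N) x by rewrite /lap /b; ring.
    rewrite lap_hump // -exprVn -/h.
    have -> : d * (-2 * h ^+ 2) = - 2 * (d * h ^+ 2) by ring.
    by rewrite -b1 /b /= hump0 humpS; ring.
  have gMC' : gam N * M - C <= 0 by rewrite subr_le0.
  have := mulr_le0_ge0 gMC' (addr_ge0 i1 i2); rewrite normr0; lra.
move=> x i /andP[x1 xN]; have xN1 : (0 < x <= N)%N by rewrite (ltnW xN) (ltnW x1).
apply: le_trans (ub x i xN1) _.
have /andP[_ j1] := @hump01 R N x (leqW (ltnW xN)).
rewrite /b (gtn_eqF x1) (ltn_eqF xN).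
have l1 : d * hump R N x <= d by rewrite ler_piMr // ltW.
have l2 : d * (h ^+ 2 / gam N) <= d * (2 / Ups) by rewrite ler_wpM2l // ltW.
have l3 : d + d * (2 / Ups) = C.
  by rewrite -[X in X + _]mulr1 -mulrDr /d divfK // lt0r_neq0 // addr_gt0.
have l4 : 0 <= d * (2 / Ups) by rewrite mulr_ge0 // ltW.
have l5 : C + C <= e by rewrite /C; lra.
by case: i; rewrite ?addr0 ?mulr0; lra.
Qed.

(** * From lattice sites to macroscopic points, and conclusion *)

Lemma site_close (R : realType) (y : R) (N : nat) : (0 < N)%N -> 0 < y < 1 ->
  [/\ (0 < site y N <= N)%N, y * N%:R <= (site y N)%:R, (site y N)%:R < y * N%:R + 1
    & `|(site y N)%:R / N.+1%:R - y| <= N.+1%:R^-1].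
Proof.
move=> N0 /andP[y0 y1]; have n0 : (0 : R) < N%:R by rewrite ltr0n.
have c0 : 0 < Num.ceil (y * N%:R) by rewrite ceil_gt0 mulr_gt0.
have sE : (site y N)%:R = (Num.ceil (y * N%:R))%:~R :> R.
  by rewrite /site natr_absz gtr0_norm.
have /andP[l1 l2] := ceil_itv (y * N%:R).
have l3 : (site y N)%:R < y * N%:R + 1 by move: l1; rewrite sE intrD; lra.
rewrite -sE in l2.
have sN : (site y N <= N)%N.
  by rewrite -lez_nat /site gez0_abs ?(ltW c0) // ceil_le_int ger_pMl // ltW.
split => //.
  by rewrite sN andbT absz_gt0 gt_eqF.
have S0 : (0 : R) < N.+1%:R by [].
have -> : (site y N)%:R / N.+1%:R - y = ((site y N)%:R - y * N.+1%:R) / N.+1%:R.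
  by rewrite mulrBl mulfK // gt_eqF.
rewrite normrM [`|_^-1|]ger0_norm ?invr_ge0 // ler_piMl ?invr_ge0 //.
by rewrite -natr1 ler_norml; lra.
Qed.

Lemma cvg_EFin_dist (R : realType) (f : nat -> \bar R) (l : R) :
  (forall e : R, 0 < e -> exists K, forall N, (K <= N)%N ->
     exists2 r : R, f N = r%:E & `|r - l| <= e) ->
  f @ \oo --> l%:E.
Proof.
move=> h; apply/fine_cvgP; split.
  by have [K hK] := h 1 ltr01; exists K => // N /= /hK[r -> _].
apply/cvgrPdist_le => e e0; have [K hK] := h e e0.
by exists K => // N /= /hK[r /= -> hr]; rewrite distrC.
Qed.

Theorem mainTheorem8 (R : realType) (sigma : int) (eps Ups rL0 rL1 rR0 rR1 : R)
    (gam : nat -> R) (pi : forall N : nat, config N -> R) :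
  sigma \in [:: -1; 0; 1] ->
  0 <= eps <= 1 ->
  0 <= rL0 -> 0 <= rL1 -> 0 <= rR0 -> 0 <= rR1 ->
  (sigma = -1 -> [/\ rL0 <= 1, rL1 <= 1, rR0 <= 1 & rR1 <= 1]) ->
  0 < Ups ->
  (forall N, (0 < N)%N -> 0 < gam N) ->
  (fun N : nat => gam N * N%:R ^+ 2) @ \oo --> Ups ->
  (forall N, (0 < N)%N ->
     is_stationary sigma eps (gam N) (fun i => if i then rL1 else rL0)
       (fun i => if i then rR1 else rR0) (pi N)) ->
  (eps = 0 ->
     forall y : R, 0 < y < 1 -> forall i : bool,
       (fun N : nat => theta sigma (pi N) i (site y N)) @ \oo
         --> (rL0 + (rR0 - rL0) * y)%:E) /\
  (0 < eps ->
     (forall y : R, 0 < y < 1 -> forall i : bool,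
       (fun N : nat => theta sigma (pi N) i (site y N)) @ \oo
         --> (rho_stat eps Ups rL0 rL1 rR0 rR1 i y)%:E) /\
     (forall e : R, 0 < e -> \forall N \near \oo,
        forall y : R, 0 < y < 1 -> forall i : bool,
          (`| theta sigma (pi N) i (site y N)
              - (rho_stat eps Ups rL0 rL1 rR0 rR1 i y)%:E | < e%:E)%E)).
Proof.
move=> hs /andP[e0 e1] rL0p rL1p rR0p rR1p hle U0 g0 hc hst.
pose rL i := if i then rL1 else rL0; pose rR i := if i then rR1 else rR0.
have mean N : (0 < N)%N -> exists t : nat -> bool -> R,
    (forall x i, theta sigma (pi N) i x = (t x i)%:E) /\
    (forall x i, (0 < x <= N)%N -> meanop N eps (gam N) rL rR t x i = 0).
  move=> N0; apply: (@stationary_mean_equation R N sigma eps (gam N) rL rR) => //.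
  - exact: g0.
  - by case.
  - by case.
  - by move=> /hle[? ? ? ?] [].
  - by move=> /hle[? ? ? ?] [].
  - exact: hst.
split=> [eps0 y hy i|eps_gt0].
  apply: cvg_EFin_dist => e e_gt0; rewrite eps0 in mean.
  have e2 : 0 < e / 2 by rewrite divr_gt0.
  have [K1 hK1] := @blocked_mean_profile_close R Ups rL rR gam U0 g0 hc _ e2.
  have [K2 hK2] := inv_succ_small (normr_ge0 (rR0 - rL0)) e2.
  have /andP[y0 y1] := hy.
  have [K3 hK3] := inv_succ_small (ler01 : 0 <= 1 :> R) y0.
  have y1' : 0 < 1 - y by rewrite subr_gt0.
  have [K4 hK4] := inv_succ_small (ler01 : 0 <= 1 :> R) y1'.
  exists (maxn (maxn K1 K2) (maxn K3.+2 K4.+2)) => N.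
  rewrite !geq_max => /andP[/andP[NK1 NK2] /andP[NK3 NK4]].
  (* [N = n.+2] makes the bounds from [K3] and [K4] speak of [1 / (N - 1)], which yields the strict
     [1 < y * N]. Both depend on [y] and keep the site off the two ends. *)
  have [n nE] : exists n, N = n.+2 by case: (N) NK3 => [|[|n]] // _; exists n.
  rewrite nE !ltnS in NK3 NK4.
  have N0 : (0 < N)%N by rewrite nE.
  have [t [tE teq]] := mean N N0; have [s0 s1 s2 s3] := site_close N0 hy.
  have S0 : (0 : R) < n.+1%:R by [].
  have nN : n.+1%:R + 1 = N%:R :> R by rewrite nE natr1.
  have yN : 1 < y * N%:R.
    by have := hK3 n NK3; rewrite ler_pdivrMr // -nN; lra.
  have yN' : 1 <= (1 - y) * N%:R.
    by have := hK4 n NK4; rewrite ler_pdivrMr // -nN; lra.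
  have sb : (1 < site y N < N)%N.
    by apply/andP; split; rewrite -(ltr_nat R); lra.
  exists (t (site y N) i); first exact: tE.
  have a1 := hK1 N NK1 t teq _ i sb.
  have a2 : `|(rR0 - rL0) * ((site y N)%:R / N.+1%:R - y)| <= e / 2.
    rewrite normrM; apply: le_trans (hK2 N NK2); exact: ler_wpM2l.
  move: a1 a2; rewrite /rL /rR mulrBr; move: (_ * (_ / _)) => z.
  by rewrite !ler_norml; lra.
have eps01 : 0 < eps <= 1 by rewrite eps_gt0.
(* [K] is found before [y], so one estimate yields both the pointwise and the uniform limit. *)
have unif (e : R) : 0 < e -> exists K, forall N, (K <= N)%N -> forall y : R, 0 < y < 1 -> forall i,
    exists2 r : R, theta sigma (pi N) i (site y N) = r%:E &
      `|r - rho_stat eps Ups rL0 rL1 rR0 rR1 i y| <= e.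
  move=> e_gt0; have e2 : 0 < e / 2 by rewrite divr_gt0.
  have [K1 hK1] := mean_profile_close rL0 rL1 rR0 rR1 eps01 U0 g0 hc e2.
  have [L L0 hL] := rho_stat_lipschitz rL0 rL1 rR0 rR1 eps01 U0.
  have [K2 hK2] := inv_succ_small L0 e2.
  exists (maxn 1 (maxn K1 K2)) => N; rewrite !geq_max => /and3P[N0 NK1 NK2] y hy i.
  have [t [tE teq]] := mean N N0; have [s0 s1 s2 s3] := site_close N0 hy.
  exists (t (site y N) i); first exact: tE.
  have a1 := hK1 N NK1 t teq _ i s0.
  have /andP[y0 y1] := hy.
  have y01 : 0 <= y <= 1 by rewrite !ltW.
  have hx : 0 <= ((site y N)%:R / N.+1%:R : R) <= 1.
    rewrite divr_ge0 //= ler_pdivrMr // mul1r ler_nat.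
    by case/andP: s0 => _ h; rewrite (leq_trans h).
  have a2 : `|rho_stat eps Ups rL0 rL1 rR0 rR1 i ((site y N)%:R / N.+1%:R)
      - rho_stat eps Ups rL0 rL1 rR0 rR1 i y| <= e / 2.
    apply: le_trans (hL i _ _ hx y01) _.
    by apply: le_trans (hK2 N NK2); exact: ler_wpM2l.
  by move: a1 a2; rewrite !ler_norml; lra.
split=> [y hy i|e e_gt0].
  apply: cvg_EFin_dist => e e_gt0; have [K hK] := unif e e_gt0.
  by exists K => N NK; exact: hK.
have e2 : 0 < e / 2 by rewrite divr_gt0.
have [K hK] := unif _ e2; exists K => // N /= NK y hy i.
have [r -> hr] := hK N NK y hy i.
rewrite -EFinB abse_EFin lte_fin; apply: le_lt_trans hr _; lra.
Qed.
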